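(* The analysis of radial selfsimilar solutions for both the porous medium equation (PME), when $m\neq 1$, and the $p$-Laplacian equation (PLE), when $p\neq 2$, can be reduced to a particular case of the autonomous ODE system $$\dot\Psi=\Psi\Phi,\qquad \dot\Phi=c_1\Phi^2-c_2\Psi\Phi-c_3\Phi\pm\Psi+\operatorname{sgn}(b),$$ where the parameters $c_1,c_2,c_3$ and $b$ are explicit functions of $n$, $m$ and $\beta$ in the PME case, and of $n$, $p$ and $\beta$ in the PLE case. The variables $\Phi$ and $\Psi$ are given by algebraic expressions in terms of $\eta,f,f'$, which are different for the two equations. It follows that a translation rule can be set up from the PME into the PLE and vice versa, which involves changing the space dimension in the process. Besides, there are in general two options for the equivalence map in either direction.
   Context: The PME is $u_t=\Delta(u^m/m)$; besides $m>1$, the range $m<1$ is included, and $m\le 0$ is also allowed. The PLE is $u_t=\nabla\cdot(|\nabla u|^{p-2}\nabla u)$ with $1<p<\infty$. Selfsimilar solutions are those of the form $u(x,t)=t^{-\alpha}f(x\,t^{-\beta})$ (Type I) or $u(x,t)=(T-t)^{\alpha}f(x\,(T-t)^{\beta})$ (Type II). The exponents satisfy $(m-1)\alpha+2\beta=\pm1$ for the PME and $(p-2)\alpha+p\beta=\pm1$ for the PLE, with $+$ for Type I and $-$ for Type II. The sign $\pm$ in the ODE system is likewise $+$ for Type I and $-$ for Type II. For radial profiles $f=f(\eta)$, $\eta>0$, with $'=d/d\eta$, the profile equations are $\eta^{1-n}(\eta^{n-1}f^{m-1}f')'+\alpha f+\beta\eta f'=0$ for the PME and $\eta^{1-n}(\eta^{n-1}|f'|^{p-2}f')'+\alpha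 f+\beta\eta f'=0$ for the PLE. In them the space dimension $n$ may be any positive real number. PME variables and constants: $$\Phi=\frac{2+(1-m)\,\eta f'/f}{\sqrt{|b|}},\quad \Psi=\frac{\eta^2f^{1-m}}{|b|},\quad b=\frac{2n(m-m_c)}{m-1},\quad c_1=\frac{m}{m-1},\quad c_2=\beta\sqrt{|b|},\quad c_3=\frac{(n+2)(m-m_s)}{(m-1)\sqrt{|b|}},$$ with $m_c=(n-2)/n$ and $m_s=(n-2)/(n+2)$. PLE variables and constants, with $X=-\eta^2|f'|^{1-p}f'$ (taken to be positive), $Y=-\eta|f'|^{-p}f'f$ and $\gamma=p/(2-p)$: $$\Phi=-\frac{p-2}{(p-1)\sqrt{|b|}}(\gamma-n+\alpha Y-\beta X),\quad \Psi=\frac{X}{|b|(p-1)},\quad b=\frac{p(n+1)(p-p_c)}{(p-2)(p-1)},$$ $$c_1=\frac{p-1}{p-2},\quad c_2=\beta\sqrt{|b|},\quad c_3=\frac{(n+2)(p-p_s)}{(p-2)\sqrt{|b|}},$$ with $p_c=2n/(n+1)$ and $p_s=2n/(n+2)$. In both cases the over-dot is differentiation with respect to $r_1=\sqrt{|b|}\log\eta$. In the critical cases $m=m_c$ or $p=p_c$, where $b=0$, the quantity $\sqrt{|b|}$ is replaced by $n-2$ for the PME and by $n$ for the PLE, so that $c_3=-1$, and the term $\operatorname{sgn}(b)$ disappears from the system. The translation rule (equivalence map) is the correspondence between selfsimilar solutions of the PME with parameters $(m,n,\beta)$ and of the PLE with parameters $(p,n',\beta')$ obtained by choosing the parameters so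 that the two resulting systems are identified, i.e. their constants take the same values.
   Formalization: In the translation from the PME into the PLE, the PLE exponent alpha is assumed nonzero (for alpha = 0 only trajectories on one explicit curve come from PLE profiles); and for m = 0, n = 2, where the replacement n-2 of sqrt|b| vanishes, the value 1 is used. *)

(* Defs.v *)
From Stdlib Require Import Reals.
From Coquelicot Require Import Coquelicot.
Open Scope R_scope.

Inductive ss_type := TypeI | TypeII.

Definition ss_sgn (ty : ss_type) : R :=
  match ty with TypeI => 1 | TypeII => -1 end.

Definition ss_time (ty : ss_type) (T t : R) : Prop :=
  match ty with TypeI => 0 < t | TypeII => t < T end.

Definition ss_eta (ty : ss_type) (T beta r t : R) : R :=
  match ty with
  | TypeI => r * Rpower t (- beta)
  | TypeII => r * Rpower (T - t) beta
  end.

(* The radial function u(r,t), r = |x|.  The blow-up time T is irrelevant for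
   Type I. *)
Definition selfsimilar (ty : ss_type) (T alpha beta : R) (f : R -> R)
    (r t : R) : R :=
  match ty with
  | TypeI => Rpower t (- alpha) * f (ss_eta ty T beta r t)
  | TypeII => Rpower (T - t) alpha * f (ss_eta ty T beta r t)
  end.

Definition ss_dom (ty : ss_type) (T beta : R) (D : R -> Prop) (r t : R) : Prop :=
  ss_time ty T t /\ D (ss_eta ty T beta r t).

Definition Ioo (a b : Rbar) (x : R) : Prop := Rbar_lt a x /\ Rbar_lt x b.

(* The set of eta > 0 for which r1 = s * ln eta lies in J.  For s <> 0 and J an
   open interval these are all the open subintervals of (0,+oo). *)
Definition eta_dom (s : R) (J : R -> Prop) (eta : R) : Prop :=
  0 < eta /\ J (s * ln eta).

(** * The autonomous system *)

(* [sign] vanishes at 0, so the last term disappears in the critical cases. *)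
Definition solves_system (ty : ss_type) (c1 c2 c3 b : R) (J : R -> Prop)
    (Phi Psi : R -> R) : Prop :=
  forall r, J r ->
    is_derive Psi r (Psi r * Phi r) /\
    is_derive Phi r (c1 * Phi r ^ 2 - c2 * Psi r * Phi r - c3 * Phi r
                     + ss_sgn ty * Psi r + sign b).

(** * Porous medium equation *)

Definition pme_mc (n : R) : R := (n - 2) / n.
Definition pme_ms (n : R) : R := (n - 2) / (n + 2).
Definition pme_b (m n : R) : R := 2 * n * (m - pme_mc n) / (m - 1).

(* The quantity sqrt|b|, replaced by n - 2 when b = 0.  If b = 0 and n = 2 (that
   is, m = 0) this replacement also vanishes; then the coefficient of Phi is
   zero as well, no rescaling is needed and the value 1 is used. *)
Definition pme_scale (m n : R) : R :=
  if Req_EM_T (pme_b m n) 0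
  then (if Req_EM_T n 2 then 1 else n - 2)
  else sqrt (Rabs (pme_b m n)).

Definition pme_c1 (m : R) : R := m / (m - 1).
Definition pme_c2 (m n beta : R) : R := beta * pme_scale m n.
Definition pme_c3 (m n : R) : R :=
  (n + 2) * (m - pme_ms n) / ((m - 1) * pme_scale m n).

(* u_t = r^{1-n} (r^{n-1} u^{m-1} u_r)_r, i.e. u_t = Delta(u^m/m) for radial
   positive u; this form makes sense for every real n and m, including m = 0. *)
Definition pme_radial_solution (m n : R) (Q : R -> R -> Prop) (u : R -> R -> R) :
    Prop :=
  forall r t, Q r t ->
    let flux := fun x => Rpower x (n - 1) * Rpower (u x t) (m - 1)
                         * Derive (fun y => u y t) x in
    0 < u r t /\
    ex_derive (fun s => u r s) t /\
    ex_derive (fun x => u x t) r /\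
    ex_derive flux r /\
    Derive (fun s => u r s) t = Rpower r (1 - n) * Derive flux r.

Definition pme_profile (m n alpha beta : R) (D : R -> Prop) (f : R -> R) : Prop :=
  forall eta, D eta ->
    let flux := fun x => Rpower x (n - 1) * Rpower (f x) (m - 1) * Derive f x in
    0 < f eta /\
    ex_derive f eta /\
    ex_derive flux eta /\
    Rpower eta (1 - n) * Derive flux eta + alpha * f eta
      + beta * eta * Derive f eta = 0.

Definition pme_Phi (m n : R) (f : R -> R) (eta : R) : R :=
  (2 + (1 - m) * (eta * Derive f eta / f eta)) / pme_scale m n.

(* |b| is the square of sqrt|b|, and is replaced accordingly when b = 0. *)
Definition pme_Psi (m n : R) (f : R -> R) (eta : R) : R :=
  eta ^ 2 * Rpower (f eta) (1 - m) / pme_scale m n ^ 2.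

(** * p-Laplacian equation *)

Definition ple_pc (n : R) : R := 2 * n / (n + 1).
Definition ple_ps (n : R) : R := 2 * n / (n + 2).
Definition ple_b (p n : R) : R :=
  p * (n + 1) * (p - ple_pc n) / ((p - 2) * (p - 1)).

Definition ple_scale (p n : R) : R :=
  if Req_EM_T (ple_b p n) 0 then n else sqrt (Rabs (ple_b p n)).

Definition ple_c1 (p : R) : R := (p - 1) / (p - 2).
Definition ple_c2 (p n beta : R) : R := beta * ple_scale p n.
Definition ple_c3 (p n : R) : R :=
  (n + 2) * (p - ple_ps n) / ((p - 2) * ple_scale p n).

(* No sign is imposed on u or f.  Rpower 0 _ = 1 in the library, so
   Rpower |v| (p - 2) * v is 0 at v = 0, as it should be. *)
Definition ple_radial_solution (p n : R) (Q : R -> R -> Prop) (u : R -> R -> R) :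
    Prop :=
  forall r t, Q r t ->
    let flux := fun x => Rpower x (n - 1)
                         * Rpower (Rabs (Derive (fun y => u y t) x)) (p - 2)
                         * Derive (fun y => u y t) x in
    ex_derive (fun s => u r s) t /\
    ex_derive (fun x => u x t) r /\
    ex_derive flux r /\
    Derive (fun s => u r s) t = Rpower r (1 - n) * Derive flux r.

Definition ple_profile (p n alpha beta : R) (D : R -> Prop) (f : R -> R) : Prop :=
  forall eta, D eta ->
    let flux := fun x => Rpower x (n - 1) * Rpower (Rabs (Derive f x)) (p - 2)
                         * Derive f x in
    ex_derive f eta /\
    ex_derive flux eta /\
    Rpower eta (1 - n) * Derive flux eta + alpha * f eta
      + beta * eta * Derive f eta = 0.

Definition ple_X (p : R) (f : R -> R) (eta : R) : R :=
  - eta ^ 2 * Rpower (Rabs (Derive f eta)) (1 - p) * Derive f eta.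
Definition ple_Y (p : R) (f : R -> R) (eta : R) : R :=
  - eta * Rpower (Rabs (Derive f eta)) (- p) * Derive f eta * f eta.
Definition ple_gamma (p : R) : R := p / (2 - p).

Definition ple_Phi (p n alpha beta : R) (f : R -> R) (eta : R) : R :=
  - ((p - 2) / ((p - 1) * ple_scale p n))
  * (ple_gamma p - n + alpha * ple_Y p f eta - beta * ple_X p f eta).

Definition ple_Psi (p n : R) (f : R -> R) (eta : R) : R :=
  ple_X p f eta / (ple_scale p n ^ 2 * (p - 1)).

Definition ple_profile_pos (p n alpha beta : R) (D : R -> Prop) (f : R -> R) :
    Prop :=
  ple_profile p n alpha beta D f /\ (forall eta, D eta -> 0 < ple_X p f eta).

(** * Translation rule *)

(* For eps = 1 the constants of the two systems take the same values.  The case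
   eps = -1 accounts for the invariance of the system under
   (r1, Phi, c2, c3) -> (-r1, -Phi, -c2, -c3), i.e. for the other choice of the
   square root of |b| in one of the equations. *)
Definition identified (eps m n beta p n' beta' : R) : Prop :=
  pme_c1 m = ple_c1 p /\
  pme_c2 m n beta = eps * ple_c2 p n' beta' /\
  pme_c3 m n = eps * ple_c3 p n' /\
  sign (pme_b m n) = sign (ple_b p n').

(* A PME profile f and a PLE profile g with the same trajectory, up to the
   reflection above; eta = exp (r / s), eta' = exp (eps * r / s'). *)
Definition corresponding (eps m n p n' alpha' beta' : R) (J : R -> Prop)
    (f g : R -> R) : Prop :=
  forall r, J r ->
    let eta := exp (r / pme_scale m n) in
    let eta' := exp (eps * r / ple_scale p n') in
    ple_Psi p n' g eta' = pme_Psi m n f eta /\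
    ple_Phi p n' alpha' beta' g eta' = eps * pme_Phi m n f eta.

(* The two options, from PME to PLE (with p = m + 1) ... *)
Definition to_ple_dim1 (m n : R) : R := (m + 1) * (n - 2) / (2 * m).
Definition to_ple_beta1 (m beta : R) : R := 2 * m / (m + 1) * beta.
Definition to_ple_dim2 (m n : R) : R := (m + 1) * (2 - n) / (2 + n * (m - 1)).
Definition to_ple_beta2 (m n beta : R) : R :=
  (2 + n * (m - 1)) / (m + 1) * beta.

(* ... and from PLE to PME (with m = p - 1). *)
Definition to_pme_dim1 (p n' : R) : R := 2 + 2 * (p - 1) * n' / p.
Definition to_pme_beta1 (p beta' : R) : R := p / (2 * (p - 1)) * beta'.
Definition to_pme_dim2 (p n' : R) : R := 2 * (p - n') / (p + n' * (p - 2)).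
Definition to_pme_beta2 (p n' beta' : R) : R :=
  (p + n' * (p - 2)) / (2 * (p - 1)) * beta'.

(* Main.v *)
Require Import Defs.
From Stdlib Require Import Reals Lra FunctionalExtensionality Classical.
From Coquelicot Require Import Coquelicot.
Open Scope R_scope.

(** The whole theorem rests on one observation: in the logarithmic variable
[r1 = s * ln eta] each profile equation, of second order and with
coefficients depending on [eta], becomes a first-order autonomous system for
two quantities that are invariant under the scaling group.

Both equations have the form u_t = r^(1-n) (F (r, u, u_r))_r with a
homogeneous flux F.  Inserting a selfsimilar [u], every term is the same power
of the clock variable ([t] or [T - t]) times a function of [eta], and the
relation between [alpha] and [beta] is what makes the two powers agree
([radial_selfsimilar_iff]).  At clock time 1 the slice of [u] is the profile
itself, which gives the converse.

For the PME the natural unknown is the logarithmic slope w = eta f' / f.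
The flux is the product of a positive power function of [eta] and [f] with [w],
so it is differentiable exactly when [w] is, and the profile equation becomes
an explicit formula for w' in terms of [w] and eta^2 f^(1-m)
([pme_profile_slope_iff]).  Up to affine changes of variables these two are
[Phi] and [Psi].  Conversely [Psi] determines [f] by a power, and the first
equation of the system says that [Phi] is then the slope of this [f].

For the PLE with f' < 0 the natural unknown is -f', whose logarithmic
derivative times [eta] is an affine function of [X] and [Y] ([ple_profile_pos_gradient_iff]);
[Psi] is a multiple of [X] and [Phi] encodes alpha Y - beta X.  Conversely [X]
determines f'.  If [alpha <> 0], [Y] is recovered from [Phi], then [f] from [Y],
and the second equation of the system guarantees that the two are consistent.
If [alpha = 0], [Phi] carries no information on [Y]: it has to be a given
function of [Psi], and [f] is an antiderivative, unique up to a constant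
([ple_of_system], [ple_unique]).

Translating a solution is then going down to the system from one side and up on
the other ([translation]); the reversal of [r1] handles [eps = -1].

There are two options because of a quadratic equation.  The constants [c1]
agree iff p = m + 1.  With x = n (m - m_c) / (2 m) and
y = (n' + 1) (p - p_c) / p both scales are multiples of one function of [x],
respectively [y] ([unit_scale]), and the squared equation for [c3] is
(x + 1)^2 y = (y + 1)^2 x, that is (x - y) (x y - 1) = 0.  So either y = x or
y = 1 / x, and each is a linear-fractional relation between the dimensions
([unit_scale_balance], [identified_iff]). *)

(** * Domains and the logarithmic coordinate *)

(** The derivative lemmas state equations in carriers of canonical structures over the
    reals, which [field], [ring] and [rewrite] recognize only as equations in [R]. *)
Ltac as_real_eq := match goal with |- @eq _ ?a ?b => change (@eq R a b) end.

(** Derivatives at a point need the equations nearby, and all powers of [x] need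
    [0 < x]; this is the property of [eta_dom] used in the two reductions. *)
Definition open_positive (D : R -> Prop) : Prop :=
  forall x, D x -> 0 < x /\ locally x D.

Lemma Ioo_open (a b : Rbar) (x : R) : Ioo a b x -> locally x (Ioo a b).
Proof.
  intros [Ha Hb]. apply filter_and.
  - exact (open_Rbar_gt a x Ha).
  - exact (open_Rbar_lt b x Hb).
Qed.

Lemma Rpower_pos (x y : R) : 0 < Rpower x y.
Proof. apply exp_pos. Qed.

Lemma eta_dom_open_positive (s : R) (a b : Rbar) : open_positive (eta_dom s (Ioo a b)).
Proof.
  intros x [Hx HJ]. split; [exact Hx|].
  apply filter_and.
  - apply open_gt. exact Hx.
  - assert (Hc : continuous (fun y => s * ln y) x).
    { apply (ex_derive_continuous (fun y => s * ln y)). auto_derive. exact Hx. }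
    apply Hc. apply Ioo_open. exact HJ.
Qed.

(** [r = s * ln eta] is a bijection because [s <> 0]; the sign of [s] is arbitrary, since
    the critical scale [n - 2] can be negative. *)
Lemma eta_dom_exp (s : R) (J : R -> Prop) (r : R) :
  s <> 0 -> (eta_dom s J (exp (r / s)) <-> J r).
Proof.
  intros Hs. unfold eta_dom. rewrite ln_exp.
  replace (s * (r / s)) with r by (field; exact Hs).
  split; [tauto|]. intros H; split; [apply exp_pos | exact H].
Qed.

Lemma exp_scaled_ln (s x : R) : s <> 0 -> 0 < x -> exp (s * ln x / s) = x.
Proof.
  intros Hs Hx. replace (s * ln x / s) with (ln x) by (field; exact Hs).
  apply exp_ln; exact Hx.
Qed.

(** A profile given by its derivative is determined up to one constant, which needs the
    domain to be an interval. *)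
Lemma eta_dom_convex (s : R) (a b : Rbar) (x y z : R) :
  eta_dom s (Ioo a b) x -> eta_dom s (Ioo a b) y -> x <= z <= y ->
  eta_dom s (Ioo a b) z.
Proof.
  intros [Hx [Hx1 Hx2]] [Hy [Hy1 Hy2]] [Hxz Hzy].
  assert (Hz : 0 < z) by lra.
  split; [exact Hz|].
  assert (L1 : ln x <= ln z) by (apply ln_le; assumption).
  assert (L2 : ln z <= ln y) by (apply ln_le; assumption).
  destruct (Rle_dec 0 s) as [Hs|Hs].
  - assert (s * ln x <= s * ln z) by (apply Rmult_le_compat_l; assumption).
    assert (s * ln z <= s * ln y) by (apply Rmult_le_compat_l; assumption).
    split.
    + apply Rbar_lt_le_trans with (s * ln x); assumption.
    + apply Rbar_le_lt_trans with (s * ln y); assumption.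
  - assert (s * ln z <= s * ln x) by (apply Rmult_le_compat_neg_l; lra).
    assert (s * ln y <= s * ln z) by (apply Rmult_le_compat_neg_l; lra).
    split.
    + apply Rbar_lt_le_trans with (s * ln y); assumption.
    + apply Rbar_le_lt_trans with (s * ln x); assumption.
Qed.

(** * Logarithmic derivatives *)

(** The fluxes and [Psi] are built from powers of positive functions, and logarithmic
    derivatives turn products of powers into linear combinations. *)
Definition is_log_derive (h : R -> R) (x l : R) : Prop :=
  0 < h x /\ is_derive h x (h x * l).

Lemma is_derive_eq (h : R -> R) (x d d' : R) :
  is_derive h x d -> d = d' -> is_derive h x d'.
Proof. intros H <-; exact H. Qed.

Lemma is_log_derive_eq (h : R -> R) (x l l' : R) :
  is_log_derive h x l -> l = l' -> is_log_derive h x l'.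
Proof. intros H <-; exact H. Qed.

Lemma is_log_derive_of (h : R -> R) (x d : R) :
  0 < h x -> is_derive h x d -> is_log_derive h x (d / h x).
Proof.
  intros Hp Hd. split; [exact Hp|].
  apply is_derive_eq with (1 := Hd). field. lra.
Qed.

Lemma is_log_derive_id (x : R) : 0 < x -> is_log_derive (fun y => y) x (/ x).
Proof.
  intros Hx. split; [exact Hx|].
  apply is_derive_eq with 1; [apply (is_derive_id x)| field; lra].
Qed.

Lemma is_log_derive_Rpower (h : R -> R) (q x l : R) :
  is_log_derive h x l -> is_log_derive (fun y => Rpower (h y) q) x (q * l).
Proof.
  intros [Hp Hd]. split; [apply Rpower_pos|].
  unfold Rpower.
  assert (He : ex_derive h x) by (exists (h x * l); exact Hd).
  apply is_derive_unique in Hd.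
  auto_derive; [tauto|].
  change (fun x0 => h x0) with h. rewrite Hd. field. lra.
Qed.

Lemma is_log_derive_mult (g h : R -> R) (x k l : R) :
  is_log_derive g x k -> is_log_derive h x l ->
  is_log_derive (fun y => g y * h y) x (k + l).
Proof.
  intros [Gp Gd] [Hp Hd]. split; [apply Rmult_lt_0_compat; assumption|].
  apply is_derive_eq with (1 := is_derive_mult g h x _ _ Gd Hd Rmult_comm).
  unfold plus, mult; simpl. ring.
Qed.

Lemma is_log_derive_scal (h : R -> R) (c x l : R) :
  0 < c -> is_log_derive h x l -> is_log_derive (fun y => c * h y) x l.
Proof.
  intros Hc [Hp Hd]. split; [apply Rmult_lt_0_compat; assumption|].
  apply is_derive_eq with (1 := is_derive_scal h x c _ Hd). 
  unfold scal; simpl; unfold mult; simpl. ring.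
Qed.

Lemma is_log_derive_ext_loc (g h : R -> R) (x l : R) :
  locally x (fun y => g y = h y) -> is_log_derive g x l -> is_log_derive h x l.
Proof.
  intros He [Hp Hd]. 
  assert (E := locally_singleton _ _ He). simpl in E.
  split; rewrite <- E; [exact Hp|].
  apply is_derive_ext_loc with (1 := He). exact Hd.
Qed.

Lemma is_log_derive_locally_pos (h : R -> R) (x l : R) :
  is_log_derive h x l -> locally x (fun y => 0 < h y).
Proof.
  intros [Hp Hd].
  assert (Hc : @continuous R_UniformSpace R_UniformSpace h x).
  { apply (ex_derive_continuous h x). exists (h x * l). exact Hd. }
  exact (Hc _ (open_gt 0 _ Hp)).
Qed.

(** Dividing by a positive differentiable factor loses no regularity, so the flux of a
    profile is differentiable exactly when its non-power factor is. *)
Lemma is_derive_mult_iff (P w : R -> R) (x l d : R) :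
  is_log_derive P x l ->
  (is_derive w x d <-> is_derive (fun y => P y * w y) x (P x * (l * w x + d))).
Proof.
  intros HP. split; intros H.
  - destruct HP as [Pp Pd].
    apply is_derive_eq with (1 := is_derive_mult P w x _ _ Pd H Rmult_comm).
    unfold plus, mult; simpl. ring.
  - assert (Hloc : locally x (fun y => 0 < P y)).
    { exact (is_log_derive_locally_pos P x l HP). }
    (* [w] is recovered as the product of [P * w] with the power -1 of [P]. *)
    assert (HQ := is_log_derive_Rpower P (Ropp 1) x l HP).
    assert (Pm : forall y, 0 < P y -> Rpower (P y) (Ropp 1) = / P y).
    { intros y Hy. rewrite Rpower_Ropp, Rpower_1; [reflexivity | exact Hy]. }
    apply is_derive_ext_loc with (fun y => Rpower (P y) (Ropp 1) * (P y * w y)).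
    { apply filter_imp with (2 := Hloc). intros y Hy. rewrite Pm by exact Hy. as_real_eq. field. lra. }
    destruct HQ as [Qp Qd].
    apply is_derive_eq with (1 := is_derive_mult _ _ x _ _ Qd H Rmult_comm).
    destruct HP as [Pp _]. rewrite (Pm x Pp).
    unfold plus, mult; simpl. field. lra.
Qed.

(** Chain rule for [eta = exp (r / s)], with d eta / d r = eta / s. *)
Lemma is_derive_exp_coord (h : R -> R) (s x d : R) :
  s <> 0 -> 0 < x -> is_derive h x d ->
  is_derive (fun r => h (exp (r / s))) (s * ln x) (d * (x / s)).
Proof.
  intros Hs Hx Hd.
  apply is_derive_eq with (x / s * d); [|ring].
  apply (is_derive_comp h (fun r => exp (r / s))).
  - rewrite exp_scaled_ln; assumption.
  - apply is_derive_eq with (exp (s * ln x / s) / s).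
    + auto_derive; [exact I | unfold Rdiv; ring].
    + rewrite exp_scaled_ln by assumption. reflexivity.
Qed.

(** Chain rule for [r = s * ln eta], with d r / d eta = s / eta. *)
Lemma is_derive_ln_coord (h : R -> R) (s x d : R) :
  0 < x -> is_derive h (s * ln x) d ->
  is_derive (fun y => h (s * ln y)) x (d * (s / x)).
Proof.
  intros Hx Hd.
  apply is_derive_eq with (s / x * d); [|ring].
  apply (is_derive_comp h (fun r => s * ln r)); [exact Hd|].
  auto_derive; [exact Hx | field; lra].
Qed.

(** * Selfsimilar solutions and their profiles *)

(** [F x u v] is the flux r^(n-1) A (u, u_r) at r = [x], u = [u], u_r = [v], so that both
    equations are instances of one radial conservation law. *)
Definition radial_flux (F : R -> R -> R -> R) (v : R -> R) (x : R) : R :=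
  F x (v x) (Derive v x).

(** [P] is the set of admissible values of [u]: positive numbers for the PME, all of [R]
    for the PLE. *)
Definition radial_solution (P : R -> Prop) (F : R -> R -> R -> R) (n : R)
    (Q : R -> R -> Prop) (u : R -> R -> R) : Prop :=
  forall r t, Q r t ->
    P (u r t) /\
    ex_derive (fun s => u r s) t /\
    ex_derive (fun x => u x t) r /\
    ex_derive (radial_flux F (fun x => u x t)) r /\
    Derive (fun s => u r s) t
    = Rpower r (1 - n) * Derive (radial_flux F (fun x => u x t)) r.

Definition radial_profile (P : R -> Prop) (F : R -> R -> R -> R)
    (n alpha beta : R) (D : R -> Prop) (f : R -> R) : Prop :=
  forall eta, D eta ->
    P (f eta) /\
    ex_derive f eta /\
    ex_derive (radial_flux F f) eta /\
    Rpower eta (1 - n) * Derive (radial_flux F f) eta + alpha * f eta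
      + beta * eta * Derive f eta = 0.

(** Both types of selfsimilarity are powers of this variable; they differ only in the
    sign of the exponents and in the direction of time. *)
Definition clock (ty : ss_type) (T t : R) : R :=
  match ty with TypeI => t | TypeII => T - t end.

Lemma selfsimilar_clock (ty : ss_type) (T alpha beta : R) (f : R -> R) (r t : R) :
  selfsimilar ty T alpha beta f r t
  = Rpower (clock ty T t) (- ss_sgn ty * alpha)
    * f (r * Rpower (clock ty T t) (- ss_sgn ty * beta)).
Proof.
  destruct ty; simpl.
  - replace (- (1) * alpha) with (- alpha) by ring.
    replace (- (1) * beta) with (- beta) by ring. reflexivity.
  - replace (- (-1) * alpha) with alpha by ring.
    replace (- (-1) * beta) with beta by ring. reflexivity.
Qed.

Lemma ss_dom_clock (ty : ss_type) (T beta : R) (D : R -> Prop) (r t : R) :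
  ss_dom ty T beta D r t <->
  0 < clock ty T t /\ D (r * Rpower (clock ty T t) (- ss_sgn ty * beta)).
Proof.
  destruct ty; unfold ss_dom; simpl.
  - replace (- (1) * beta) with (- beta) by ring. reflexivity.
  - replace (- (-1) * beta) with beta by ring.
    split; intros [H1 H2]; (split; [lra | exact H2]).
Qed.

Lemma ss_sgn_sqr (ty : ss_type) : ss_sgn ty * ss_sgn ty = 1.
Proof. destruct ty; simpl; ring. Qed.

Lemma is_derive_clock_Rpower (ty : ss_type) (T q t : R) :
  0 < clock ty T t ->
  is_derive (fun s => Rpower (clock ty T s) q) t
    (ss_sgn ty * q * Rpower (clock ty T t) q / clock ty T t).
Proof.
  intros Ht.
  assert (Hc : is_derive (clock ty T) t (ss_sgn ty)).
  { destruct ty; unfold clock; simpl; auto_derive; auto; ring. }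
  destruct (is_log_derive_Rpower _ q _ _ (is_log_derive_of _ _ _ Ht Hc)) as [_ H].
  apply is_derive_eq with (1 := H). field. lra.
Qed.

Lemma is_derive_scaled (f : R -> R) (A k x : R) :
  ex_derive f (x * k) ->
  is_derive (fun y => A * f (y * k)) x (A * k * Derive f (x * k)).
Proof.
  intros Hf. auto_derive; [exact Hf |]. 
  change (fun x0 => f x0) with f. ring.
Qed.

(** The sign in the exponents and the direction of the clock cancel, which is why the terms
    [alpha f + beta eta f'] enter both types of profile equation with the same sign. *)
Lemma is_derive_selfsimilar_time (ty : ss_type) (T alpha beta : R) (f : R -> R)
    (r t : R) :
  let tau := clock ty T t in
  let eta := r * Rpower tau (- ss_sgn ty * beta) in
  0 < tau -> ex_derive f eta ->
  is_derive (fun s => selfsimilar ty T alpha beta f r s) t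
    (- (Rpower tau (- ss_sgn ty * alpha) / tau
        * (alpha * f eta + beta * eta * Derive f eta))).
Proof.
  intros tau eta Ht Hf.
  apply is_derive_ext with (fun s =>
    Rpower (clock ty T s) (- ss_sgn ty * alpha)
    * f (r * Rpower (clock ty T s) (- ss_sgn ty * beta))).
  { intros s. symmetry. apply selfsimilar_clock. }
  assert (Ha := is_derive_clock_Rpower ty T (- ss_sgn ty * alpha) t Ht).
  assert (Hb := is_derive_clock_Rpower ty T (- ss_sgn ty * beta) t Ht).
  assert (Hfb := is_derive_comp f
                   (fun s => r * Rpower (clock ty T s) (- ss_sgn ty * beta)) t _ _
                   (Derive_correct _ _ Hf) (is_derive_scal _ t r _ Hb)).
  apply is_derive_eq with (1 := is_derive_mult _ _ t _ _ Ha Hfb Rmult_comm).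
  unfold plus, mult, scal; simpl; unfold mult; simpl.
  fold tau. fold eta. unfold eta. 
  assert (S := ss_sgn_sqr ty).
  assert (Hs2 : forall q z, ss_sgn ty * (- ss_sgn ty * q) * z = - (q * z)).
  { intros q z. transitivity (- (ss_sgn ty * ss_sgn ty * q * z)); [ring|].
    rewrite S. ring. }
  rewrite !Hs2. field. exact (Rgt_not_eq _ _ Ht).
Qed.

(** Homogeneity of the flux is needed only on the admissible values taken by [f] on [D], and
    openness of [D] makes the identity between fluxes hold near the point. *)
Lemma radial_flux_scaled (P : R -> Prop) (F : R -> R -> R -> R) (D : R -> Prop)
    (f : R -> R) (A k C r : R) :
  open_positive D -> 0 < k -> D (r * k) ->
  (forall x, D x -> P (f x) /\ ex_derive f x) ->
  (forall x u v, 0 < x -> P u -> F x (A * u) (A * k * v) = C * F (x * k) u v) ->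
  ex_derive (radial_flux F f) (r * k) ->
  is_derive (radial_flux F (fun x => A * f (x * k))) r
    (C * k * Derive (radial_flux F f) (r * k)).
Proof.
  intros HD Hk Hr Hf HF He.
  apply is_derive_ext_loc with (fun x => C * radial_flux F f (x * k)).
  - assert (Hc : @continuous R_UniformSpace R_UniformSpace (fun x => x * k) r).
    { apply (ex_derive_continuous (fun x => x * k) r). auto_derive. exact I. }
    assert (Hl := Hc _ (proj2 (HD _ Hr))). unfold filtermap in Hl.
    apply filter_imp with (2 := Hl). intros x Hx. simpl in Hx.
    destruct (Hf _ Hx) as [HP Hd].
    unfold radial_flux. symmetry.
    assert (E : Derive (fun y => A * f (y * k)) x = A * k * Derive f (x * k)).
    { apply is_derive_unique, is_derive_scaled, Hd. }
    rewrite E.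
    apply HF; [|exact HP].
    destruct (HD _ Hx) as [Hpos _].
    apply Rmult_lt_reg_r with k; [exact Hk | lra].
  - apply is_derive_scaled. exact He.
Qed.

(** The homogeneity hypothesis says that the diffusion term scales like
    [Rpower tau (a - 1)], which is also the power in the time derivative; then this
    power cancels.  For the converse the equation is read at clock time 1, where the
    slice of [u] is [f]. *)
Lemma radial_selfsimilar_iff (P : R -> Prop) (F : R -> R -> R -> R)
    (ty : ss_type) (T n alpha beta : R) (D : R -> Prop) (f : R -> R) :
  let a := - ss_sgn ty * alpha in
  let b := - ss_sgn ty * beta in
  open_positive D ->
  (forall tau u, 0 < tau -> P u -> P (Rpower tau a * u)) ->
  (forall tau x u v, 0 < tau -> 0 < x -> P u ->
     F x (Rpower tau a * u) (Rpower tau a * Rpower tau b * v)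
     = Rpower tau (a - 1 - b * n) * F (x * Rpower tau b) u v) ->
  radial_solution P F n (ss_dom ty T beta D) (selfsimilar ty T alpha beta f)
  <-> radial_profile P F n alpha beta D f.
Proof.
  intros a b HD HP HF. split; intros H.
  - intros eta Heta.
    (* The time at which the clock shows 1. *)
    pose (t := match ty with TypeI => 1 | TypeII => T - 1 end).
    assert (Ht : clock ty T t = 1) by (unfold t; destruct ty; simpl; ring).
    assert (Hone : forall q, Rpower 1 q = 1).
    { intros q. unfold Rpower. rewrite ln_1, Rmult_0_r. apply exp_0. }
    assert (Hslice : (fun x => selfsimilar ty T alpha beta f x t) = f).
    { apply functional_extensionality. intros x.
      rewrite selfsimilar_clock, Ht, !Hone, Rmult_1_r, Rmult_1_l. reflexivity. }
    destruct (H eta t) as (H0 & H1 & H2 & H3 & H4).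
    { apply ss_dom_clock. rewrite Ht, Hone, Rmult_1_r. split; [lra | exact Heta]. }
    assert (K0 : P (f eta)) by (rewrite <- Hslice; exact H0).
    assert (K2 : ex_derive f eta) by (rewrite <- Hslice; exact H2).
    assert (K3 : ex_derive (radial_flux F f) eta) by (rewrite <- Hslice; exact H3).
    assert (K4 : Derive (fun s => selfsimilar ty T alpha beta f eta s) t
                 = Rpower eta (1 - n) * Derive (radial_flux F f) eta).
    { exact (eq_trans H4 (f_equal (fun v => Rpower eta (1 - n) * Derive (radial_flux F v) eta) Hslice)). }
    assert (Htime := is_derive_selfsimilar_time ty T alpha beta f eta t).
    simpl in Htime. rewrite Ht, !Hone, Rmult_1_r in Htime.
    apply is_derive_unique in Htime; [|lra|exact K2].
    rewrite Htime in K4.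
    repeat split; try assumption.
    rewrite <- K4. field.
  - intros r t Hrt. apply ss_dom_clock in Hrt. destruct Hrt as [Ht Hr].
    fold b in Hr.
    destruct (H _ Hr) as (H0 & H1 & H2 & H3).
    assert (Hslice : (fun x => selfsimilar ty T alpha beta f x t)
                     = (fun x => Rpower (clock ty T t) a
                                 * f (x * Rpower (clock ty T t) b))).
    { apply functional_extensionality. intros x. apply selfsimilar_clock. }
    set (tau := clock ty T t) in *.
    assert (Hk : 0 < Rpower tau b) by apply Rpower_pos.
    assert (Hr0 : 0 < r).
    { apply Rmult_lt_reg_r with (Rpower tau b); [exact Hk|].
      rewrite Rmult_0_l. apply (HD _ Hr). }
    assert (Htime := is_derive_selfsimilar_time ty T alpha beta f r t Ht H1).
    assert (Hflux := radial_flux_scaled P F D f (Rpower tau a) (Rpower tau b)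
              (Rpower tau (a - 1 - b * n)) r HD Hk Hr
              (fun x Hx => conj (proj1 (H x Hx)) (proj1 (proj2 (H x Hx))))
              (fun x u v => HF tau x u v Ht) H2).
    rewrite Hslice.
    split; [|split; [|split; [|split]]].
    + change (selfsimilar ty T alpha beta f r t)
        with ((fun x => selfsimilar ty T alpha beta f x t) r).
      rewrite Hslice. apply HP; assumption.
    + eexists. exact Htime.
    + apply ex_derive_ext with (fun x => Rpower tau a * f (x * Rpower tau b)).
      { intros x. symmetry. apply selfsimilar_clock. }
      exists (Rpower tau a * Rpower tau b * Derive f (r * Rpower tau b)).
      exact (is_derive_scaled f (Rpower tau a) (Rpower tau b) r H1).
    + eexists. exact Hflux.
    + apply is_derive_unique in Htime, Hflux.
      etransitivity; [exact Htime|]. rewrite Hflux. clear Htime Hflux.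
      fold tau. fold a. fold b.
      set (eta := r * Rpower tau b) in *.
      set (d := Derive (radial_flux F f) eta) in *.
      assert (E : Rpower r (1 - n) * (Rpower tau (a - 1 - b * n) * Rpower tau b)
                  = Rpower tau a / tau * Rpower eta (1 - n)).
      { unfold eta. rewrite <- Rpower_mult_distr by assumption.
        rewrite Rpower_mult.
        replace (Rpower tau a / tau) with (Rpower tau (a + - (1))).
        2:{ rewrite Rpower_plus, Rpower_Ropp, Rpower_1 by exact Ht. reflexivity. }
        rewrite <- Rpower_plus.
        rewrite (Rmult_comm (Rpower r (1 - n)) (Rpower tau (b * (1 - n)))).
        rewrite <- Rmult_assoc, <- Rpower_plus, Rmult_comm.
        do 2 f_equal. ring. }
      transitivity (Rpower r (1 - n) * (Rpower tau (a - 1 - b * n) * Rpower tau b) * d).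
      * rewrite E.
        replace (alpha * f eta + beta * eta * Derive f eta)
          with (- (Rpower eta (1 - n) * d)) by (unfold d in *; lra).
        unfold Rdiv. ring.
      * ring.
Qed.

Lemma Rpower_scaled_product (tau x q k : R) : 0 < tau -> 0 < x ->
  Rpower (Rpower tau q * x) k = Rpower tau (q * k) * Rpower x k.
Proof.
  intros Ht Hx. rewrite <- Rpower_mult_distr, Rpower_mult; auto using Rpower_pos.
Qed.

Definition pme_flux (m n x u v : R) : R := Rpower x (n - 1) * Rpower u (m - 1) * v.
Definition ple_flux (p n x u v : R) : R :=
  Rpower x (n - 1) * Rpower (Rabs v) (p - 2) * v.

Lemma pme_selfsimilar_iff (ty : ss_type) (T m n alpha beta : R) (D : R -> Prop)
    (f : R -> R) :
  open_positive D -> (m - 1) * alpha + 2 * beta = ss_sgn ty ->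
  (pme_radial_solution m n (ss_dom ty T beta D) (selfsimilar ty T alpha beta f)
   <-> pme_profile m n alpha beta D f).
Proof.
  intros HD Hexp.
  apply (radial_selfsimilar_iff (fun u => 0 < u) (pme_flux m n)); [exact HD | |].
  - intros tau u Ht Hu. apply Rmult_lt_0_compat; [apply Rpower_pos | exact Hu].
  - intros tau x u v Ht Hx Hu. unfold pme_flux.
    set (a := - ss_sgn ty * alpha). set (b := - ss_sgn ty * beta).
    assert (Hab : (m - 1) * a + 2 * b = - (1)).
    { unfold a, b. transitivity (- (ss_sgn ty * ((m - 1) * alpha + 2 * beta))); [ring|].
      rewrite Hexp, ss_sgn_sqr. reflexivity. }
    rewrite (Rmult_comm x), !Rpower_scaled_product by assumption.
    replace (a - 1 - b * n) with (a * (m - 1) + a + b + - (b * (n - 1))) by lra.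
    rewrite !Rpower_plus, Rpower_Ropp. field.
    apply Rgt_not_eq, Rpower_pos.
Qed.

(** At a critical point of [f] the power of |f'| is meaningless, but both sides of the
    homogeneity relation vanish because of the factor f'. *)
Lemma ple_selfsimilar_iff (ty : ss_type) (T p n alpha beta : R) (D : R -> Prop)
    (f : R -> R) :
  open_positive D -> (p - 2) * alpha + p * beta = ss_sgn ty ->
  (ple_radial_solution p n (ss_dom ty T beta D) (selfsimilar ty T alpha beta f)
   <-> ple_profile p n alpha beta D f).
Proof.
  intros HD Hexp.
  assert (K : radial_solution (fun _ => True) (ple_flux p n) n (ss_dom ty T beta D)
                (selfsimilar ty T alpha beta f)
              <-> radial_profile (fun _ => True) (ple_flux p n) n alpha beta D f).
  { apply radial_selfsimilar_iff; [exact HD | auto |].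
    intros tau x u v Ht Hx _. unfold ple_flux.
    set (a := - ss_sgn ty * alpha). set (b := - ss_sgn ty * beta).
    assert (Hab : (p - 2) * a + p * b = - (1)).
    { unfold a, b. transitivity (- (ss_sgn ty * ((p - 2) * alpha + p * beta))); [ring|].
      rewrite Hexp, ss_sgn_sqr. reflexivity. }
    destruct (Req_dec v 0) as [-> | Hv]; [ring|].
    rewrite Rabs_mult, (Rabs_right (Rpower tau a * Rpower tau b)).
    2:{ apply Rle_ge, Rlt_le, Rmult_lt_0_compat; apply Rpower_pos. }
    rewrite (Rmult_comm x), <- Rpower_plus.
    rewrite !Rpower_scaled_product by (try assumption; now apply Rabs_pos_lt).
    replace (a - 1 - b * n) with ((a + b) * (p - 2) + (a + b) + - (b * (n - 1))) by lra.
    rewrite !Rpower_plus, Rpower_Ropp.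
    field. apply Rgt_not_eq, Rpower_pos. }
  split; intros H.
  - intros eta He. exact (proj2 (proj1 K (fun r t Hrt => conj I (H r t Hrt)) eta He)).
  - intros r t Hrt. exact (proj2 (proj2 K (fun eta He => conj I (H eta He)) r t Hrt)).
Qed.

(** * Reduction of the porous medium equation *)

Lemma Rpower_pred (x q : R) : 0 < x -> Rpower x q = Rpower x (q - 1) * x.
Proof.
  intros Hx. rewrite <- (Rpower_1 x) at 3 by exact Hx.
  rewrite <- Rpower_plus. f_equal. ring.
Qed.

Definition log_slope (f : R -> R) (eta : R) : R := eta * Derive f eta / f eta.

(** The profile equation solved for w', where w is [log_slope f]. *)
Definition pme_slope_rate (m n alpha beta : R) (f : R -> R) (eta : R) : R :=
  let w := log_slope f eta in
  ((2 - n) * w - m * w ^ 2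
   - (alpha + beta * w) * (eta ^ 2 * Rpower (f eta) (1 - m))) / eta.

Lemma is_log_derive_slope (f : R -> R) (x : R) :
  0 < x -> 0 < f x -> ex_derive f x -> is_log_derive f x (log_slope f x / x).
Proof.
  intros Hx Hp Hd. 
  apply is_log_derive_eq with (1 := is_log_derive_of _ _ _ Hp (Derive_correct _ _ Hd)).
  unfold log_slope. field. lra.
Qed.

(** The flux is eta^(n-2) f^m w, and the factor of w is a positive power function with
    logarithmic derivative (n - 2 + m w) / eta. *)
Lemma pme_flux_slope_iff (m n : R) (D : R -> Prop) (f : R -> R) (eta d : R) :
  open_positive D -> (forall x, D x -> 0 < f x /\ ex_derive f x) -> D eta ->
  let w := log_slope f eta in
  (is_derive (log_slope f) eta d <->
   is_derive (radial_flux (pme_flux m n) f) eta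
     (Rpower eta (n - 2) * Rpower (f eta) m
      * ((n - 2 + m * w) / eta * w + d))).
Proof.
  intros HD Hf He w.
  destruct (HD _ He) as [Hpos Hloc]. destruct (Hf _ He) as [Hfp Hfd].
  assert (HP : is_log_derive (fun x => Rpower x (n - 2) * Rpower (f x) m) eta
                 ((n - 2 + m * w) / eta)).
  { apply is_log_derive_eq with ((n - 2) * / eta + m * (w / eta)).
    - apply is_log_derive_mult; apply is_log_derive_Rpower.
      + apply is_log_derive_id; exact Hpos.
      + apply is_log_derive_slope; assumption.
    - field. lra. }
  assert (E : locally eta (fun x =>
     Rpower x (n - 2) * Rpower (f x) m * log_slope f x = radial_flux (pme_flux m n) f x)).
  { apply filter_imp with (2 := Hloc). intros x Hx.
    destruct (HD _ Hx) as [Hxp _]. destruct (Hf _ Hx) as [Hfx _].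
    unfold radial_flux, pme_flux, log_slope.
    rewrite (Rpower_pred x (n - 1)), (Rpower_pred (f x) m) by assumption.
    replace (n - 1 - 1) with (n - 2) by ring. field. lra. }
  split; intros H.
  - apply is_derive_ext_loc with (1 := E).
    exact (proj1 (is_derive_mult_iff _ _ _ _ _ HP) H).
  - apply (is_derive_mult_iff _ _ _ _ _ HP).
    apply is_derive_ext_loc with (2 := H).
    apply filter_imp with (2 := E). intros x Hx. symmetry. exact Hx.
Qed.

(** Up to the positive factor f^m / eta the left-hand side is [d] minus the
    claimed rate. *)
Lemma pme_equation_slope_iff (m n alpha beta : R) (f : R -> R) (eta d : R) :
  0 < eta -> 0 < f eta ->
  let w := log_slope f eta in
  (Rpower eta (1 - n) * (Rpower eta (n - 2) * Rpower (f eta) m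
      * ((n - 2 + m * w) / eta * w + d)) + alpha * f eta + beta * eta * Derive f eta = 0
   <-> d = pme_slope_rate m n alpha beta f eta).
Proof.
  intros He Hf w.
  assert (E1 : Rpower eta (1 - n) * Rpower eta (n - 2) = / eta).
  { rewrite <- Rpower_plus. replace (1 - n + (n - 2)) with (Ropp 1) by ring.
    rewrite Rpower_Ropp, Rpower_1; [reflexivity | exact He]. }
  assert (E2 : f eta = Rpower (f eta) m * Rpower (f eta) (1 - m)).
  { rewrite <- Rpower_plus. replace (m + (1 - m)) with 1 by ring.
    symmetry. apply Rpower_1; exact Hf. }
  assert (E3 : eta * Derive f eta = w * f eta).
  { unfold w, log_slope. field. lra. }
  assert (Hm := Rpower_pos (f eta) m).
  assert (E : Rpower eta (1 - n) * (Rpower eta (n - 2) * Rpower (f eta) m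
      * ((n - 2 + m * w) / eta * w + d)) + alpha * f eta + beta * eta * Derive f eta
      = Rpower (f eta) m / eta * (d - pme_slope_rate m n alpha beta f eta)).
  { transitivity (Rpower eta (1 - n) * Rpower eta (n - 2) * (Rpower (f eta) m
      * ((n - 2 + m * w) / eta * w + d)) + alpha * f eta + beta * (eta * Derive f eta));
      [ring|].
    rewrite E1, E3. unfold pme_slope_rate. fold w.
    set (M := Rpower (f eta) m) in *. set (N := Rpower (f eta) (1 - m)) in *.
    rewrite E2. field. lra. }
  rewrite E. split; intros H.
  - apply Rmult_integral in H. destruct H as [H|H]; [|lra].
    exfalso. assert (0 < Rpower (f eta) m / eta) by (apply Rdiv_lt_0_compat; assumption). lra.
  - rewrite H. ring.
Qed.

(** The second-order profile equation as a first-order one for the slope; in this form no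
    second derivative of [f] and no flux is left. *)
Lemma pme_profile_slope_iff (m n alpha beta : R) (D : R -> Prop) (f : R -> R) :
  open_positive D ->
  (pme_profile m n alpha beta D f <->
   forall eta, D eta ->
     0 < f eta /\ ex_derive f eta /\
     is_derive (log_slope f) eta (pme_slope_rate m n alpha beta f eta)).
Proof.
  intros HD. split; intros H eta He.
  - destruct (HD _ He) as [Hpos _].
    destruct (H eta He) as (H0 & H1 & H2 & H3).
    split; [exact H0 | split; [exact H1|]].
    assert (Hf : forall x, D x -> 0 < f x /\ ex_derive f x).
    { intros x Hx. destruct (H x Hx) as (? & ? & _). tauto. }
    set (w := log_slope f eta).
    set (P := Rpower eta (n - 2) * Rpower (f eta) m).
    assert (HP : 0 < P) by (apply Rmult_lt_0_compat; apply Rpower_pos).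
    change (ex_derive (radial_flux (pme_flux m n) f) eta) in H2.
    change (Rpower eta (1 - n) * Derive (radial_flux (pme_flux m n) f) eta
            + alpha * f eta + beta * eta * Derive f eta = 0) in H3.
    set (G := Derive (radial_flux (pme_flux m n) f) eta) in *.
    set (d := G / P - (n - 2 + m * w) / eta * w).
    assert (HG : G = P * ((n - 2 + m * w) / eta * w + d)) by (unfold d; field; lra).
    assert (Hd : d = pme_slope_rate m n alpha beta f eta).
    { apply (pme_equation_slope_iff m n alpha beta f eta d Hpos H0).
      fold w. fold P. rewrite <- HG. exact H3. }
    rewrite <- Hd. apply (pme_flux_slope_iff m n D f eta d HD Hf He).
    fold w. fold P. rewrite <- HG. apply Derive_correct. exact H2.
  - destruct (HD _ He) as [Hpos _].
    destruct (H eta He) as (H0 & H1 & H2).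
    assert (Hf : forall x, D x -> 0 < f x /\ ex_derive f x).
    { intros x Hx. destruct (H x Hx) as (? & ? & _). tauto. }
    apply (pme_flux_slope_iff m n D f eta _ HD Hf He) in H2.
    change (0 < f eta /\ ex_derive f eta /\ ex_derive (radial_flux (pme_flux m n) f) eta /\
      Rpower eta (1 - n) * Derive (radial_flux (pme_flux m n) f) eta
            + alpha * f eta + beta * eta * Derive f eta = 0).
    split; [exact H0 | split; [exact H1 | split]].
    + eexists. exact H2.
    + apply is_derive_unique in H2. rewrite H2.
      apply (pme_equation_slope_iff m n alpha beta f eta _ Hpos H0). reflexivity.
Qed.

(** This is how [sgn b] arises: the constant term of the equation for [Phi] is b divided by the
    square of the scale. *)
Lemma sqrt_Rabs_sign (b : R) : b <> 0 ->
  sqrt (Rabs b) <> 0 /\ sqrt (Rabs b) ^ 2 * sign b = b.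
Proof.
  intros E. split.
  - apply Rgt_not_eq, sqrt_lt_R0, Rabs_pos_lt, E.
  - rewrite pow2_sqrt by apply Rabs_pos.
    destruct (Rtotal_order b 0) as [H|[H|H]]; [|tauto|].
    + rewrite sign_eq_m1, Rabs_left by assumption. ring.
    + rewrite sign_eq_1, Rabs_right by lra. ring.
Qed.

(** All that the reduction needs about the scale.  It covers the critical case, where any
    nonzero value would do as both sides of the equation vanish. *)
Lemma pme_scale_spec (m n : R) :
  pme_scale m n <> 0 /\ pme_scale m n ^ 2 * sign (pme_b m n) = pme_b m n.
Proof.
  unfold pme_scale. destruct (Req_EM_T (pme_b m n) 0) as [E|E].
  - rewrite E, sign_0. destruct (Req_EM_T n 2); split; lra.
  - apply sqrt_Rabs_sign, E.
Qed.

(** Polynomial form of [b]; the critical exponent is meaningful only for [n <> 0]. *)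
Lemma pme_b_mul (m n : R) : m <> 1 -> n <> 0 ->
  (m - 1) * pme_b m n = 2 * (n * (m - 1) + 2).
Proof. intros. unfold pme_b, pme_mc. field. lra. Qed.

Lemma pme_c3_mul (m n : R) : m <> 1 -> n <> -2 ->
  pme_c3 m n = (n * (m - 1) + 2 + 2 * m) / ((m - 1) * pme_scale m n).
Proof.
  intros. destruct (pme_scale_spec m n). unfold pme_c3, pme_ms. field.
  repeat split; lra.
Qed.

Lemma pme_Psi_log_derive (m n : R) (f : R -> R) (x : R) :
  0 < x -> 0 < f x -> ex_derive f x ->
  is_log_derive (pme_Psi m n f) x (pme_Phi m n f x * pme_scale m n / x).
Proof.
  intros Hx Hp Hd.
  destruct (pme_scale_spec m n) as [Hs _].
  assert (Hs2 : 0 < / pme_scale m n ^ 2) by (apply Rinv_0_lt_compat, pow2_gt_0, Hs).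
  apply is_log_derive_ext_loc with
    (fun y => / pme_scale m n ^ 2 * (y * y * Rpower (f y) (1 - m))).
  { apply filter_forall. intros y. unfold pme_Psi. unfold Rdiv. as_real_eq. ring. }
  apply is_log_derive_eq with ((/ x + / x) + (1 - m) * (log_slope f x / x)).
  - apply is_log_derive_scal; [exact Hs2|].
    apply is_log_derive_mult.
    + apply is_log_derive_mult; apply is_log_derive_id; exact Hx.
    + apply is_log_derive_Rpower, is_log_derive_slope; assumption.
  - unfold pme_Phi, log_slope. field. lra.
Qed.

Lemma pme_Phi_slope (m n : R) (f : R -> R) (x : R) :
  pme_Phi m n f x = (2 + (1 - m) * log_slope f x) / pme_scale m n.
Proof. reflexivity. Qed.

(** Substituting w = (s Phi - 2) / (1 - m) and eta^2 f^(1-m) = s^2 Psi in the rate of the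
    slope gives a quadratic in [Phi]; the coefficient of [Psi] is
    (m - 1) alpha + 2 beta, which is the sign of the type. *)
Lemma pme_rate_system (ty : ss_type) (m n alpha beta : R) (f : R -> R) (x : R) :
  m <> 1 -> 0 < n -> (m - 1) * alpha + 2 * beta = ss_sgn ty -> 0 < x ->
  let s := pme_scale m n in
  let Phi := pme_Phi m n f x in
  let Psi := pme_Psi m n f x in
  (1 - m) / s * pme_slope_rate m n alpha beta f x * (x / s)
  = pme_c1 m * Phi ^ 2 - pme_c2 m n beta * Psi * Phi - pme_c3 m n * Phi
    + ss_sgn ty * Psi + sign (pme_b m n).
Proof.
  intros Hm Hn Hexp Hx s Phi Psi.
  destruct (pme_scale_spec m n) as [Hs Hb]. fold s in Hs, Hb.
  assert (Hw : log_slope f x = (s * Phi - 2) / (1 - m)).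
  { unfold Phi. rewrite pme_Phi_slope. fold s. field. lra. }
  assert (HP : x ^ 2 * Rpower (f x) (1 - m) = s ^ 2 * Psi).
  { unfold Psi, pme_Psi. fold s. field. lra. }
  unfold pme_slope_rate. rewrite HP, Hw, <- Hexp.
  rewrite pme_c3_mul by lra. fold s.
  assert (Hbm := pme_b_mul m n Hm ltac:(lra)).
  replace (sign (pme_b m n)) with (2 * (n * (m - 1) + 2) / ((m - 1) * s ^ 2)).
  2:{ rewrite <- Hbm. set (S := sign (pme_b m n)) in *. rewrite <- Hb. field. lra. }
  unfold pme_c1, pme_c2. fold s. field. lra.
Qed.

Lemma pme_to_system (ty : ss_type) (m n alpha beta : R) (a0 b0 : Rbar) (f : R -> R) :
  m <> 1 -> 0 < n -> (m - 1) * alpha + 2 * beta = ss_sgn ty ->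
  let s := pme_scale m n in
  let D := eta_dom s (Ioo a0 b0) in
  pme_profile m n alpha beta D f ->
  (forall eta, D eta -> 0 < pme_Psi m n f eta) /\
  solves_system ty (pme_c1 m) (pme_c2 m n beta) (pme_c3 m n) (pme_b m n) (Ioo a0 b0)
    (fun r => pme_Phi m n f (exp (r / s))) (fun r => pme_Psi m n f (exp (r / s))).
Proof.
  intros Hm Hn Hexp s D Hprof.
  assert (HD : open_positive D) by apply eta_dom_open_positive.
  assert (Hs : s <> 0) by apply pme_scale_spec.
  assert (Hode := proj1 (pme_profile_slope_iff m n alpha beta D f HD) Hprof).
  split.
  - intros eta He. destruct (Hode _ He) as (H0 & H1 & _).
    apply (pme_Psi_log_derive m n f eta (proj1 (HD _ He)) H0 H1).
  - intros r Hr. apply (eta_dom_exp s _ r Hs) in Hr. fold D in Hr.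
    set (eta := exp (r / s)) in *.
    destruct (HD _ Hr) as [Hpos _]. destruct (Hode _ Hr) as (H0 & H1 & H2).
    assert (Er : r = s * ln eta).
    { unfold eta. rewrite ln_exp. field. exact Hs. }
    split.
    + destruct (pme_Psi_log_derive m n f eta Hpos H0 H1) as [_ Hd].
      rewrite Er at 1.
      apply is_derive_eq with (1 := is_derive_exp_coord _ s eta _ Hs Hpos Hd).
      fold s. field. split; lra.
    + rewrite Er at 1. 
      assert (Hd : is_derive (pme_Phi m n f) eta
                     ((1 - m) / s * pme_slope_rate m n alpha beta f eta)).
      { apply is_derive_ext with (fun y => 2 / s + (1 - m) / s * log_slope f y).
        - intros y. rewrite pme_Phi_slope. fold s. as_real_eq. field. exact Hs.
        - apply is_derive_eq with (1 := is_derive_plus _ _ eta _ _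
            (is_derive_const (2 / s) eta) (is_derive_scal _ eta ((1 - m) / s) _ H2)).
          unfold plus, zero; simpl. ring. }
      apply is_derive_eq with (1 := is_derive_exp_coord _ s eta _ Hs Hpos Hd).
      apply pme_rate_system; assumption.
Qed.

(** The definition of [Psi] is solved for [f].  The first equation of the system then says
    that [Phi] is the normalized slope of [f], and the second one is the slope form of the
    profile equation. *)
Lemma pme_of_system (ty : ss_type) (m n alpha beta : R) (a0 b0 : Rbar)
    (Phi Psi : R -> R) :
  m <> 1 -> 0 < n -> (m - 1) * alpha + 2 * beta = ss_sgn ty ->
  let s := pme_scale m n in
  let D := eta_dom s (Ioo a0 b0) in
  solves_system ty (pme_c1 m) (pme_c2 m n beta) (pme_c3 m n) (pme_b m n) (Ioo a0 b0)
    Phi Psi ->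
  (forall r, Ioo a0 b0 r -> 0 < Psi r) ->
  exists f : R -> R, pme_profile m n alpha beta D f /\
    forall eta, D eta -> pme_Phi m n f eta = Phi (s * ln eta) /\
                         pme_Psi m n f eta = Psi (s * ln eta).
Proof.
  intros Hm Hn Hexp s D Hsys HPsi.
  assert (HD : open_positive D) by apply eta_dom_open_positive.
  assert (Hs : s <> 0) by apply pme_scale_spec.
  assert (Hs2 : 0 < s ^ 2) by (apply pow2_gt_0; exact Hs).
  (* The solution of eta^2 f^(1-m) = s^2 Psi. *)
  pose (f := fun x => Rpower (s ^ 2 * (Psi (s * ln x) * Rpower x (Ropp 2))) (/ (1 - m))).
  assert (Hlog : forall x, D x ->
            is_log_derive f x (/ (1 - m) * (Phi (s * ln x) * s / x + Ropp 2 * / x))).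
  { intros x [Hx HJ]. apply is_log_derive_Rpower.
    apply is_log_derive_scal; [exact Hs2|].
    apply is_log_derive_mult.
    - split; [apply HPsi; exact HJ|].
      apply is_derive_eq with (1 := is_derive_ln_coord Psi s x _ Hx (proj1 (Hsys _ HJ))).
      field. lra.
    - apply is_log_derive_Rpower, is_log_derive_id; exact Hx. }
  assert (HfPsi : forall x, D x -> pme_Psi m n f x = Psi (s * ln x)).
  { intros x [Hx HJ]. unfold pme_Psi, f. fold s.
    rewrite Rpower_mult. replace (/ (1 - m) * (1 - m)) with 1 by (field; lra).
    assert (HPx := HPsi _ HJ).
    rewrite Rpower_1.
    2:{ apply Rmult_lt_0_compat; [exact Hs2|].
        apply Rmult_lt_0_compat; [exact HPx | apply Rpower_pos]. }
    rewrite Rpower_Ropp. 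
    replace (Rpower x 2) with (x ^ 2) by (symmetry; exact (Rpower_pow 2 x Hx)).
    field. split; lra. }
  assert (Hslope : forall x, D x -> log_slope f x = (s * Phi (s * ln x) - 2) / (1 - m)).
  { intros x Hx. destruct (HD _ Hx) as [Hpos _]. destruct (Hlog x Hx) as [Hp Hd].
    apply is_derive_unique in Hd. unfold log_slope. rewrite Hd. field. lra. }
  assert (HfPhi : forall x, D x -> pme_Phi m n f x = Phi (s * ln x)).
  { intros x Hx. rewrite pme_Phi_slope, Hslope by exact Hx. fold s. field. lra. }
  exists f. split; [|intros eta He; split; auto].
  apply (pme_profile_slope_iff m n alpha beta D f HD).
  intros eta He. destruct (HD _ He) as [Hpos Hloc]. destruct (Hlog eta He) as [Hp Hd].
  split; [exact Hp | split; [eexists; exact Hd|]].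
  apply is_derive_ext_loc with (fun x => Ropp 2 / (1 - m) + s / (1 - m) * Phi (s * ln x)).
  { apply filter_imp with (2 := Hloc). intros x Hx. rewrite Hslope by exact Hx. as_real_eq. field. lra. }
  assert (HPd := is_derive_ln_coord Phi s eta _ Hpos (proj2 (Hsys _ (proj2 He)))).
  apply is_derive_eq with (1 := is_derive_plus _ _ eta _ _
            (is_derive_const (Ropp 2 / (1 - m)) eta) (is_derive_scal _ eta (s / (1 - m)) _ HPd)).
  unfold plus, zero; simpl.
  rewrite <- (HfPhi eta He), <- (HfPsi eta He).
  assert (K := pme_rate_system ty m n alpha beta f eta Hm Hn Hexp Hpos).
  simpl in K. rewrite <- K. fold s. field. lra.
Qed.

Lemma Rpower_inj (q x y : R) : q <> 0 -> 0 < x -> 0 < y ->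
  Rpower x q = Rpower y q -> x = y.
Proof.
  intros Hq Hx Hy E. apply exp_inv in E. apply Rmult_eq_reg_l in E; [|exact Hq].
  apply ln_inv; assumption.
Qed.

Lemma pme_Psi_inj (m n : R) (f1 f2 : R -> R) (eta : R) :
  m <> 1 -> 0 < eta -> 0 < f1 eta -> 0 < f2 eta ->
  pme_Psi m n f1 eta = pme_Psi m n f2 eta -> f1 eta = f2 eta.
Proof.
  intros Hm He H1 H2 E. destruct (pme_scale_spec m n) as [Hs _].
  apply (Rpower_inj (1 - m)); try assumption; [lra|].
  unfold pme_Psi, Rdiv in E.
  apply Rmult_eq_reg_r in E.
  2:{ apply Rgt_not_eq, Rinv_0_lt_compat, pow2_gt_0, Hs. }
  apply Rmult_eq_reg_l in E; [exact E|].
  apply Rgt_not_eq, pow2_gt_0. lra.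
Qed.

(** * Reduction of the p-Laplacian equation *)

Lemma ple_X_pos_iff (p : R) (f : R -> R) (x : R) :
  0 < x -> (0 < ple_X p f x <-> 0 < - Derive f x).
Proof.
  intros Hx. unfold ple_X.
  assert (H : 0 < x ^ 2 * Rpower (Rabs (Derive f x)) (1 - p)).
  { apply Rmult_lt_0_compat; [apply pow2_gt_0; lra | apply Rpower_pos]. }
  set (k := x ^ 2 * _) in *.
  replace (- x ^ 2 * Rpower (Rabs (Derive f x)) (1 - p) * Derive f x)
    with (k * - Derive f x) by (unfold k; ring).
  split; intros H1.
  - apply Rmult_lt_reg_l with k; [exact H | lra].
  - apply Rmult_lt_0_compat; assumption.
Qed.

Lemma ple_X_eq (p : R) (f : R -> R) (x : R) : 0 < - Derive f x ->
  ple_X p f x = x * x * Rpower (- Derive f x) (2 - p).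
Proof.
  intros H. unfold ple_X. rewrite Rabs_left by lra.
  rewrite (Rpower_pred (- Derive f x) (2 - p)) by exact H.
  replace (2 - p - 1) with (1 - p) by ring. ring.
Qed.

Lemma ple_Y_eq (p : R) (f : R -> R) (x : R) : 0 < - Derive f x ->
  ple_Y p f x = x * Rpower (- Derive f x) (1 - p) * f x.
Proof.
  intros H. unfold ple_Y. rewrite Rabs_left by lra.
  rewrite (Rpower_pred (- Derive f x) (1 - p)) by exact H.
  replace (1 - p - 1) with (- p) by ring. ring.
Qed.

(** Logarithmic derivative of -f' according to the profile equation. *)
Definition ple_gradient_rate (p n alpha beta : R) (f : R -> R) (x : R) : R :=
  (alpha * ple_Y p f x - beta * ple_X p f x - (n - 1)) / ((p - 1) * x).

(** For f' < 0 the flux is -eta^(n-1) (-f')^(p-1), a product of powers in which -f' has a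
    nonzero exponent; so it can be solved for -f' by a power. *)
Lemma ple_flux_gradient_iff (p n : R) (D : R -> Prop) (f : R -> R) (eta l : R) :
  open_positive D -> 1 < p -> (forall x, D x -> 0 < - Derive f x) -> D eta ->
  (is_log_derive (fun x => - Derive f x) eta l <->
   is_log_derive (fun x => - radial_flux (ple_flux p n) f x) eta
     ((n - 1) / eta + (p - 1) * l)).
Proof.
  intros HD Hp Hf He. destruct (HD _ He) as [Hpos Hloc].
  assert (E : forall x, D x -> Rpower x (n - 1) * Rpower (- Derive f x) (p - 1)
                               = - radial_flux (ple_flux p n) f x).
  { intros x Hx. assert (Hg := Hf _ Hx). unfold radial_flux, ple_flux.
    rewrite Rabs_left by lra.
    rewrite (Rpower_pred (- Derive f x) (p - 1)) by exact Hg.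
    replace (p - 1 - 1) with (p - 2) by ring. ring. }
  assert (E' : forall x, D x ->
     Rpower (Rpower x (1 - n) * (- radial_flux (ple_flux p n) f x)) (/ (p - 1))
     = - Derive f x).
  { intros x Hx. rewrite <- E by exact Hx. rewrite <- Rmult_assoc, <- Rpower_plus.
    replace (1 - n + (n - 1)) with 0 by ring.
    rewrite Rpower_O by apply (HD _ Hx). rewrite Rmult_1_l, Rpower_mult.
    replace ((p - 1) * / (p - 1)) with 1 by (field; lra).
    apply Rpower_1, Hf, Hx. }
  split; intros H.
  - apply is_log_derive_ext_loc
      with (fun x => Rpower x (n - 1) * Rpower (- Derive f x) (p - 1)).
    { apply filter_imp with (2 := Hloc). exact E. }
    apply is_log_derive_mult.
    + apply (is_log_derive_Rpower (fun x => x) (n - 1) eta (/ eta)).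
      apply is_log_derive_id; exact Hpos.
    + apply (is_log_derive_Rpower (fun x => - Derive f x)); exact H.
  - apply is_log_derive_ext_loc with (fun x =>
      Rpower (Rpower x (1 - n) * (- radial_flux (ple_flux p n) f x)) (/ (p - 1))).
    { apply filter_imp with (2 := Hloc). exact E'. }
    apply is_log_derive_eq with (/ (p - 1) * ((1 - n) * / eta + ((n - 1) / eta + (p - 1) * l))).
    + apply (is_log_derive_Rpower
               (fun x => Rpower x (1 - n) * (- radial_flux (ple_flux p n) f x))).
      apply is_log_derive_mult; [|exact H].
      apply (is_log_derive_Rpower (fun x => x)), is_log_derive_id; exact Hpos.
    + field. lra.
Qed.

(** After multiplication by eta (-f')^(1-p), alpha f + beta eta f' becomes
    alpha Y - beta X. *)
Lemma ple_equation_gradient_iff (p n alpha beta : R) (f : R -> R) (eta d : R) :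
  0 < eta -> 1 < p -> 0 < - Derive f eta ->
  (Rpower eta (1 - n) * d + alpha * f eta + beta * eta * Derive f eta = 0 <->
   - d = - radial_flux (ple_flux p n) f eta
         * ((n - 1) / eta + (p - 1) * ple_gradient_rate p n alpha beta f eta)).
Proof.
  intros He Hp Hg. unfold ple_gradient_rate.
  rewrite ple_X_eq, ple_Y_eq by exact Hg.
  unfold radial_flux, ple_flux. rewrite Rabs_left by lra.
  set (g := - Derive f eta) in *. replace (Derive f eta) with (- g) by (unfold g; ring).
  rewrite (Rpower_pred g (2 - p)) by exact Hg.
  replace (2 - p - 1) with (1 - p) by ring.
  assert (E1 : Rpower g (p - 2) * g * Rpower g (1 - p) = 1).
  { replace (p - 2) with ((p - 1) - 1) by ring. rewrite <- Rpower_pred by exact Hg.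
    rewrite <- Rpower_plus. replace (p - 1 + (1 - p)) with 0 by ring. 
    apply Rpower_O; exact Hg. }
  assert (E2 : Rpower eta (n - 1) * Rpower eta (1 - n) = 1).
  { rewrite <- Rpower_plus. replace (n - 1 + (1 - n)) with 0 by ring. 
    apply Rpower_O; exact He. }
  assert (Hh := Rpower_pos eta (1 - n)).
  set (M := Rpower g (p - 2)) in *. set (N := Rpower g (1 - p)) in *.
  set (h := Rpower eta (1 - n)) in *. set (k := Rpower eta (n - 1)) in *.
  replace (- (k * M * - g) *
     ((n - 1) / eta +
      (p - 1) *
      ((alpha * (eta * N * f eta) - beta * (eta * eta * (N * g)) - (n - 1)) /
       ((p - 1) * eta))))
    with (M * g * N * (k * (alpha * f eta - beta * eta * g))) by (field; lra).
  rewrite E1. split; intros H.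
  - transitivity (- (k * h) * d); [rewrite E2; ring|].
    transitivity (k * - (h * d)); [ring|].
    replace (- (h * d)) with (alpha * f eta - beta * eta * g) by lra. ring.
  - replace (h * d) with (- (h * - d)) by ring. rewrite H.
    transitivity ((1 - k * h) * (alpha * f eta - beta * eta * g)); [ring|].
    rewrite E2. ring.
Qed.

Lemma ple_profile_pos_gradient_iff (p n alpha beta : R) (D : R -> Prop) (f : R -> R) :
  open_positive D -> 1 < p ->
  (ple_profile_pos p n alpha beta D f <->
   forall eta, D eta -> ex_derive f eta /\
     is_log_derive (fun x => - Derive f x) eta (ple_gradient_rate p n alpha beta f eta)).
Proof.
  intros HD Hp. split.
  - intros [H HX] eta He. destruct (HD _ He) as [Hpos _].
    destruct (H eta He) as (H0 & H1 & H2).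
    change (ex_derive (radial_flux (ple_flux p n) f) eta) in H1.
    change (Rpower eta (1 - n) * Derive (radial_flux (ple_flux p n) f) eta
            + alpha * f eta + beta * eta * Derive f eta = 0) in H2.
    assert (Hg : forall x, D x -> 0 < - Derive f x).
    { intros x Hx. apply (ple_X_pos_iff p f x); [apply HD; exact Hx | apply HX; exact Hx]. }
    split; [exact H0|].
    apply (ple_flux_gradient_iff p n D f eta _ HD Hp Hg He).
    split.
    + unfold radial_flux, ple_flux.
      rewrite Ropp_mult_distr_r. apply Rmult_lt_0_compat; [|auto].
      apply Rmult_lt_0_compat; apply Rpower_pos.
    + apply (ple_equation_gradient_iff p n alpha beta f eta _ Hpos Hp (Hg _ He)) in H2.
      rewrite <- H2. apply (is_derive_opp (radial_flux (ple_flux p n) f)).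
      apply Derive_correct. exact H1.
  - intros H.
    assert (Hg : forall x, D x -> 0 < - Derive f x).
    { intros x Hx. apply (H x Hx). }
    split; [|intros x Hx; apply ple_X_pos_iff; [apply HD|]; auto].
    intros eta He. destruct (HD _ He) as [Hpos _].
    destruct (H eta He) as (H0 & H1).
    apply (ple_flux_gradient_iff p n D f eta _ HD Hp Hg He) in H1.
    destruct H1 as [_ H1].
    set (R0 := - radial_flux (ple_flux p n) f eta * _) in H1.
    assert (H2 : is_derive (radial_flux (ple_flux p n) f) eta (- R0)).
    { apply is_derive_ext with (fun x => - - radial_flux (ple_flux p n) f x).
      - intros x. as_real_eq. ring.
      - apply (is_derive_opp (fun x => - radial_flux (ple_flux p n) f x)). exact H1. }
    split; [exact H0 | split].
    + eexists. exact H2.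
    + change (Rpower eta (1 - n) * Derive (radial_flux (ple_flux p n) f) eta
            + alpha * f eta + beta * eta * Derive f eta = 0).
      apply is_derive_unique in H2. rewrite H2.
      apply (ple_equation_gradient_iff p n alpha beta f eta _ Hpos Hp (Hg _ He)).
      rewrite Ropp_involutive. reflexivity.
Qed.

(** As for the PME, both the general and the critical scale have the only two properties
    used. *)
Lemma ple_scale_spec (p n : R) : n <> 0 ->
  ple_scale p n <> 0 /\ ple_scale p n ^ 2 * sign (ple_b p n) = ple_b p n.
Proof.
  intros Hn. unfold ple_scale. destruct (Req_EM_T (ple_b p n) 0) as [E|E].
  - rewrite E, sign_0. split; lra.
  - apply sqrt_Rabs_sign, E.
Qed.

Lemma ple_b_mul (p n : R) : p <> 2 -> p <> 1 -> n <> -1 ->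
  (p - 2) * (p - 1) * ple_b p n = p * (p + n * (p - 2)).
Proof. intros. unfold ple_b, ple_pc. field. repeat split; lra. Qed.

Lemma ple_c3_mul (p n : R) : p <> 2 -> n <> -2 -> ple_scale p n <> 0 ->
  ple_c3 p n = (p + n * (p - 2) + p) / ((p - 2) * ple_scale p n).
Proof. intros. unfold ple_c3, ple_ps. field. repeat split; lra. Qed.

(** X is eta^2 (-f')^(2-p), so its logarithmic derivative is
    (2 + (2 - p) eta l) / eta with l that of -f'.  [Phi] is defined so that this is
    s Phi / eta. *)
Lemma ple_Phi_gradient (p n alpha beta : R) (f : R -> R) (x : R) :
  1 < p -> p <> 2 -> n <> 0 -> 0 < x ->
  (2 - p) * ple_gradient_rate p n alpha beta f x
  = (ple_scale p n * ple_Phi p n alpha beta f x - 2) / x.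
Proof.
  intros Hp Hp2 Hn Hx. destruct (ple_scale_spec p n Hn) as [Hs _].
  unfold ple_gradient_rate, ple_Phi, ple_gamma. field. repeat split; lra.
Qed.

Lemma ple_X_log_derive (p n alpha beta : R) (D : R -> Prop) (f : R -> R) (x : R) :
  open_positive D -> 1 < p -> p <> 2 -> n <> 0 ->
  ple_profile_pos p n alpha beta D f -> D x ->
  is_log_derive (ple_X p f) x (ple_scale p n * ple_Phi p n alpha beta f x / x).
Proof.
  intros HD Hp Hp2 Hn Hprof Hx. destruct (HD _ Hx) as [Hpos Hloc].
  assert (Hode := proj1 (ple_profile_pos_gradient_iff p n alpha beta D f HD Hp) Hprof).
  apply is_log_derive_ext_loc with (fun y => y * y * Rpower (- Derive f y) (2 - p)).
  { apply filter_imp with (2 := Hloc). intros y Hy. symmetry. apply ple_X_eq.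
    apply (Hode y Hy). }
  apply is_log_derive_eq with ((/ x + / x) + (2 - p) * ple_gradient_rate p n alpha beta f x).
  - apply is_log_derive_mult.
    + apply is_log_derive_mult; apply is_log_derive_id; exact Hpos.
    + apply (is_log_derive_Rpower (fun y => - Derive f y)). apply (Hode x Hx).
  - rewrite (ple_Phi_gradient p n alpha beta f x Hp Hp2 Hn Hpos). field. lra.
Qed.

(** Y = eta (-f')^(1-p) f, and f' contributes the term -X because
    eta (-f')^(1-p) f' = -X / eta. *)
Lemma ple_Y_derive (p n alpha beta : R) (D : R -> Prop) (f : R -> R) (x : R) :
  open_positive D -> 1 < p ->
  ple_profile_pos p n alpha beta D f -> D x ->
  let X := ple_X p f x in
  let Y := ple_Y p f x in
  is_derive (ple_Y p f) x ((Y * (n - alpha * Y + beta * X) - X) / x).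
Proof.
  intros HD Hp Hprof Hx X Y. destruct (HD _ Hx) as [Hpos Hloc].
  assert (Hode := proj1 (ple_profile_pos_gradient_iff p n alpha beta D f HD Hp) Hprof).
  destruct (Hode x Hx) as [Hd Hl].
  apply is_derive_ext_loc with (fun y => y * Rpower (- Derive f y) (1 - p) * f y).
  { apply filter_imp with (2 := Hloc). intros y Hy. symmetry. apply ple_Y_eq.
    apply (Hode y Hy). }
  assert (HP := is_log_derive_mult _ _ _ _ _ (is_log_derive_id x Hpos)
                  (is_log_derive_Rpower _ (1 - p) _ _ Hl)).
  apply is_derive_eq with (1 := proj1 (is_derive_mult_iff _ _ _ _ _ HP) (Derive_correct _ _ Hd)).
  assert (EY : Y = x * Rpower (- Derive f x) (1 - p) * f x) by (apply ple_Y_eq; apply Hl).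
  assert (EX : X = - x * (x * Rpower (- Derive f x) (1 - p) * Derive f x)).
  { unfold X. rewrite ple_X_eq, (Rpower_pred _ (2 - p)) by apply Hl.
    replace (2 - p - 1) with (1 - p) by ring. ring. }
  unfold ple_gradient_rate. fold X. fold Y.
  transitivity ((/ x + (1 - p) * ((alpha * Y - beta * X - (n - 1)) / ((p - 1) * x)))
                * (x * Rpower (- Derive f x) (1 - p) * f x)
                + x * Rpower (- Derive f x) (1 - p) * Derive f x); [ring|].
  rewrite <- EY.
  replace (x * Rpower (- Derive f x) (1 - p) * Derive f x) with (- X / x).
  2:{ rewrite EX. field. lra. }
  field. lra.
Qed.

(** A polynomial identity in [X] and [Y]: the system is closed because alpha Y - beta X
    is an affine function of [Phi], and the remaining [X] is a multiple of [Psi].  Its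
    coefficient is (p - 2) alpha + p beta, the sign of the type. *)
Lemma ple_rate_system (ty : ss_type) (p n alpha beta X Y : R) :
  1 < p -> p <> 2 -> 0 < n -> (p - 2) * alpha + p * beta = ss_sgn ty ->
  let s := ple_scale p n in
  let Phi := - ((p - 2) / ((p - 1) * s)) * (ple_gamma p - n + alpha * Y - beta * X) in
  let Psi := X / (s ^ 2 * (p - 1)) in
  - ((p - 2) / ((p - 1) * s))
    * (alpha * ((Y * (n - alpha * Y + beta * X) - X)) - beta * (X * (s * Phi))) / s
  = ple_c1 p * Phi ^ 2 - ple_c2 p n beta * Psi * Phi - ple_c3 p n * Phi
    + ss_sgn ty * Psi + sign (ple_b p n).
Proof.
  intros Hp Hp2 Hn Hexp s Phi Psi.
  destruct (ple_scale_spec p n ltac:(lra)) as [Hs Hb]. 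
  rewrite ple_c3_mul by (try exact Hs; lra).
  fold s in Hs, Hb. fold s.
  rewrite <- Hexp.
  replace (sign (ple_b p n)) with (p * (p + n * (p - 2)) / ((p - 2) * (p - 1) * s ^ 2)).
  2:{ rewrite <- ple_b_mul by lra. set (S := sign (ple_b p n)) in *.
      rewrite <- Hb. field. repeat split; lra. }
  unfold Phi, Psi, ple_c1, ple_c2, ple_gamma. fold s. field. repeat split; lra.
Qed.

Lemma ple_to_system (ty : ss_type) (p n alpha beta : R) (a0 b0 : Rbar) (f : R -> R) :
  1 < p -> p <> 2 -> 0 < n -> (p - 2) * alpha + p * beta = ss_sgn ty ->
  let s := ple_scale p n in
  let D := eta_dom s (Ioo a0 b0) in
  ple_profile_pos p n alpha beta D f ->
  (forall eta, D eta -> 0 < ple_Psi p n f eta) /\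
  solves_system ty (ple_c1 p) (ple_c2 p n beta) (ple_c3 p n) (ple_b p n) (Ioo a0 b0)
    (fun r => ple_Phi p n alpha beta f (exp (r / s)))
    (fun r => ple_Psi p n f (exp (r / s))).
Proof.
  intros Hp Hp2 Hn Hexp s D Hprof.
  assert (HD : open_positive D) by apply eta_dom_open_positive.
  assert (Hn0 : n <> 0) by lra.
  assert (Hs : s <> 0) by (apply ple_scale_spec; exact Hn0).
  assert (Hs2 : 0 < s ^ 2) by (apply pow2_gt_0; exact Hs).
  split.
  - intros eta He. apply Rdiv_lt_0_compat; [apply (proj2 Hprof); exact He|].
    apply Rmult_lt_0_compat; [exact Hs2 | lra].
  - intros r Hr. apply (eta_dom_exp s _ r Hs) in Hr. fold D in Hr.
    set (eta := exp (r / s)) in *.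
    destruct (HD _ Hr) as [Hpos _].
    assert (Er : r = s * ln eta).
    { unfold eta. rewrite ln_exp. field. exact Hs. }
    destruct (ple_X_log_derive p n alpha beta D f eta HD Hp Hp2 Hn0 Hprof Hr) as [HXp HX].
    fold s in HX.
    assert (HY := ple_Y_derive p n alpha beta D f eta HD Hp Hprof Hr). simpl in HY.
    split.
    + rewrite Er at 1.
      assert (Hd : is_derive (ple_Psi p n f) eta
                     (/ (s ^ 2 * (p - 1)) * (ple_X p f eta * (s * ple_Phi p n alpha beta f eta / eta)))).
      { apply is_derive_ext with (fun y => / (s ^ 2 * (p - 1)) * ple_X p f y).
        - intros y. unfold ple_Psi, Rdiv. fold s. as_real_eq. ring.
        - exact (is_derive_scal _ eta _ _ HX). }
      apply is_derive_eq with (1 := is_derive_exp_coord _ s eta _ Hs Hpos Hd).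
      unfold ple_Psi. fold s. field. repeat split; lra.
    + rewrite Er at 1.
      set (c := - ((p - 2) / ((p - 1) * s))).
      assert (Hd : is_derive (ple_Phi p n alpha beta f) eta
         (c * (alpha * ((ple_Y p f eta * (n - alpha * ple_Y p f eta + beta * ple_X p f eta)
                         - ple_X p f eta) / eta)
               - beta * (ple_X p f eta * (s * ple_Phi p n alpha beta f eta / eta))))).
      { apply is_derive_ext with (fun y =>
          c * (ple_gamma p - n) + (c * alpha * ple_Y p f y - c * beta * ple_X p f y)).
        - intros y. unfold ple_Phi. fold s. fold c. as_real_eq. ring.
        - apply is_derive_eq with (1 := is_derive_plus _ _ eta _ _
            (is_derive_const (c * (ple_gamma p - n)) eta)
            (is_derive_minus _ _ eta _ _ (is_derive_scal _ eta (c * alpha) _ HY)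
                                         (is_derive_scal _ eta (c * beta) _ HX))).
          unfold minus, plus, opp, zero; simpl. ring. }
      apply is_derive_eq with (1 := is_derive_exp_coord _ s eta _ Hs Hpos Hd).
      assert (K := ple_rate_system ty p n alpha beta (ple_X p f eta) (ple_Y p f eta)
                     Hp Hp2 Hn Hexp).
      cbv zeta in K. fold s c in K.
      fold s. unfold ple_Psi. fold s.
      change (ple_Phi p n alpha beta f eta)
        with (c * (ple_gamma p - n + alpha * ple_Y p f eta - beta * ple_X p f eta)).
      rewrite <- K. field. lra.
Qed.

(** The common part of the two reconstructions of a profile.  If -g is the derivative of [f]
    and [g] is the power of [Psi] dictated by the definition of [X], then the only remaining
    condition is the defining formula of [Phi]. *)
Lemma ple_profile_of_slope (p n alpha beta : R) (a0 b0 : Rbar)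
    (Phi Psi f g : R -> R) :
  1 < p -> p <> 2 -> 0 < n ->
  let s := ple_scale p n in
  let D := eta_dom s (Ioo a0 b0) in
  (forall x, D x -> 0 < g x) ->
  (forall x, D x -> x * x * Rpower (g x) (2 - p) = s ^ 2 * (p - 1) * Psi (s * ln x)) ->
  (forall r, Ioo a0 b0 r -> is_derive Psi r (Psi r * Phi r)) ->
  (forall x, D x -> is_derive f x (- g x)) ->
  (forall x, D x -> Phi (s * ln x) = - ((p - 2) / ((p - 1) * s))
     * (ple_gamma p - n + alpha * (x * Rpower (g x) (1 - p) * f x)
        - beta * (s ^ 2 * (p - 1) * Psi (s * ln x)))) ->
  ple_profile_pos p n alpha beta D f /\
  forall eta, D eta -> ple_Phi p n alpha beta f eta = Phi (s * ln eta) /\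
                       ple_Psi p n f eta = Psi (s * ln eta).
Proof.
  intros Hp Hp2 Hn s D Hg HX HPsi Hf HPhi.
  assert (HD : open_positive D) by apply eta_dom_open_positive.
  assert (Hn0 : n <> 0) by lra.
  assert (Hs : s <> 0) by (apply ple_scale_spec; exact Hn0).
  assert (Hs2 : 0 < s ^ 2) by (apply pow2_gt_0; exact Hs).
  assert (Dg : forall x, D x -> - Derive f x = g x).
  { intros x Hx. assert (E := is_derive_unique _ _ _ (Hf x Hx)). rewrite E. ring. }
  assert (EX : forall x, D x -> ple_X p f x = s ^ 2 * (p - 1) * Psi (s * ln x)).
  { intros x Hx. rewrite ple_X_eq by (rewrite Dg by exact Hx; auto).
    rewrite Dg by exact Hx. auto. }
  assert (EPhi : forall x, D x -> ple_Phi p n alpha beta f x = Phi (s * ln x)).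
  { intros x Hx. rewrite HPhi by exact Hx. unfold ple_Phi. fold s.
    rewrite EX by exact Hx.
    rewrite ple_Y_eq by (rewrite Dg by exact Hx; auto).
    rewrite Dg by exact Hx. reflexivity. }
  split.
  - apply (ple_profile_pos_gradient_iff p n alpha beta D f HD Hp).
    intros x Hx. destruct (HD _ Hx) as [Hpos Hloc].
    split; [eexists; exact (Hf x Hx)|].
    apply is_log_derive_ext_loc with (fun y =>
      Rpower (s ^ 2 * (p - 1) * (Psi (s * ln y) * Rpower y (Ropp 2))) (/ (2 - p))).
    { apply filter_imp with (2 := Hloc). intros y Hy. as_real_eq. rewrite Dg by exact Hy.
      destruct (HD _ Hy) as [Hy0 _].
      rewrite <- Rmult_assoc, <- HX by exact Hy.
      rewrite Rpower_Ropp.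
      replace (Rpower y 2) with (y ^ 2) by (symmetry; exact (Rpower_pow 2 y Hy0)).
      replace (y * y * Rpower (g y) (2 - p) * / y ^ 2) with (Rpower (g y) (2 - p))
        by (field; lra).
      rewrite Rpower_mult. replace ((2 - p) * / (2 - p)) with 1 by (field; lra).
      apply Rpower_1. auto. }
    apply is_log_derive_eq with (/ (2 - p) * (Phi (s * ln x) * s / x + Ropp 2 * / x)).
    + apply (is_log_derive_Rpower
               (fun y => s ^ 2 * (p - 1) * (Psi (s * ln y) * Rpower y (Ropp 2)))).
      apply is_log_derive_scal; [apply Rmult_lt_0_compat; lra|].
      apply is_log_derive_mult.
      * split.
        -- apply Rmult_lt_reg_l with (s ^ 2 * (p - 1)); [apply Rmult_lt_0_compat; lra|].
           rewrite Rmult_0_r, <- HX by exact Hx.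
           apply Rmult_lt_0_compat; [apply Rmult_lt_0_compat; exact Hpos | apply Rpower_pos].
        -- apply is_derive_eq with (1 := is_derive_ln_coord Psi s x _ Hpos (HPsi _ (proj2 Hx))).
           field. lra.
      * apply (is_log_derive_Rpower (fun y => y)), is_log_derive_id; exact Hpos.
    + apply Rmult_eq_reg_l with (2 - p); [|lra].
      rewrite (ple_Phi_gradient p n alpha beta f x Hp Hp2 Hn0 Hpos).
      rewrite EPhi by exact Hx. fold s. field. lra.
  - intros x Hx. split; [auto|].
    unfold ple_Psi. fold s. rewrite EX by exact Hx. field. split; lra.
Qed.

(** [Psi] determines the candidate [g] for -f'.  If [alpha = 0] any antiderivative of -g is
    a profile, provided [Phi] is the prescribed function of [Psi].  If [alpha <> 0], [Y] and
    therefore [f] are given by [Phi], and f' = -g is a consequence of the second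
    equation. *)
Lemma ple_of_system (ty : ss_type) (p n alpha beta : R) (a0 b0 : Rbar)
    (Phi Psi : R -> R) :
  1 < p -> p <> 2 -> 0 < n -> (p - 2) * alpha + p * beta = ss_sgn ty ->
  let s := ple_scale p n in
  let J := Ioo a0 b0 in
  let D := eta_dom s J in
  solves_system ty (ple_c1 p) (ple_c2 p n beta) (ple_c3 p n) (ple_b p n) J Phi Psi ->
  (forall r, J r -> 0 < Psi r) ->
  ((exists f : R -> R, ple_profile_pos p n alpha beta D f /\
     forall eta, D eta -> ple_Phi p n alpha beta f eta = Phi (s * ln eta) /\
                          ple_Psi p n f eta = Psi (s * ln eta))
   <->
   (alpha <> 0 \/
    forall r, J r ->
      Phi r = - ((p - 2) / ((p - 1) * s))
              * (ple_gamma p - n - beta * (s ^ 2 * (p - 1) * Psi r)))).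
Proof.
  intros Hp Hp2 Hn Hexp s J D Hsys HPsi.
  assert (HD : open_positive D) by apply eta_dom_open_positive.
  assert (Hn0 : n <> 0) by lra.
  assert (Hs : s <> 0) by (apply ple_scale_spec; exact Hn0).
  assert (Hs2 : 0 < s ^ 2) by (apply pow2_gt_0; exact Hs).
  assert (Hk : 0 < s ^ 2 * (p - 1)) by (apply Rmult_lt_0_compat; lra).
  split.
  - intros [f [Hprof Hf]].
    destruct (Req_dec alpha 0) as [Ha|Ha]; [right | left; exact Ha].
    intros r Hr. apply (eta_dom_exp s _ r Hs) in Hr. fold D in Hr.
    destruct (Hf _ Hr) as [HPhi HPs]. revert HPhi HPs.
    rewrite ln_exp. replace (s * (r / s)) with r by (field; exact Hs).
    intros HPhi HPs. rewrite <- HPhi, <- HPs.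
    unfold ple_Phi, ple_Psi. fold s. rewrite Ha. field. repeat split; lra.
  - intros Hor.
    (* The solution of eta^2 g^(2-p) = X, with X given by Psi. *)
    pose (g := fun x => Rpower (s ^ 2 * (p - 1) * (Psi (s * ln x) * Rpower x (Ropp 2))) (/ (2 - p))).
    assert (Hg : forall x, 0 < g x) by (intros x; apply Rpower_pos).
    assert (HX : forall x, D x -> x * x * Rpower (g x) (2 - p) = s ^ 2 * (p - 1) * Psi (s * ln x)).
    { intros x [Hx HJ]. unfold g. rewrite Rpower_mult.
      replace (/ (2 - p) * (2 - p)) with 1 by (field; lra).
      assert (HPx := HPsi _ HJ).
      rewrite Rpower_1.
      2:{ apply Rmult_lt_0_compat; [exact Hk|].
          apply Rmult_lt_0_compat; [exact HPx | apply Rpower_pos]. }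
      rewrite Rpower_Ropp.
      replace (Rpower x 2) with (x ^ 2) by (symmetry; exact (Rpower_pow 2 x Hx)).
      field. lra. }
    assert (Hgl : forall x, D x ->
              is_log_derive g x (/ (2 - p) * (Phi (s * ln x) * s / x + Ropp 2 * / x))).
    { intros x [Hx HJ].
      apply (is_log_derive_Rpower
               (fun y => s ^ 2 * (p - 1) * (Psi (s * ln y) * Rpower y (Ropp 2)))).
      apply is_log_derive_scal; [exact Hk|].
      apply is_log_derive_mult.
      - split; [apply HPsi; exact HJ|].
        apply is_derive_eq with (1 := is_derive_ln_coord Psi s x _ Hx (proj1 (Hsys _ HJ))).
        field. lra.
      - apply (is_log_derive_Rpower (fun y => y)), is_log_derive_id; exact Hx. }
    destruct (Req_dec alpha 0) as [Ha|Ha].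
    + destruct Hor as [Hor|Hor]; [contradiction|].
      destruct (classic (exists x, D x)) as [[x0 Hx0]|HE].
      * assert (Hex : forall y, D y -> ex_RInt g x0 y).
        { intros y Hy. apply (ex_RInt_continuous g). intros z Hz.
          apply (ex_derive_continuous g). eexists. apply (Hgl z).
          destruct (Rle_dec x0 y) as [L|L].
          - rewrite Rmin_left, Rmax_right in Hz by lra.
            apply (eta_dom_convex s a0 b0 x0 y); assumption.
          - rewrite Rmin_right, Rmax_left in Hz by lra.
            apply (eta_dom_convex s a0 b0 y x0); assumption. }
        exists (fun y => - RInt g x0 y).
        apply (ple_profile_of_slope p n alpha beta a0 b0 Phi Psi _ g Hp Hp2 Hn); auto.
        -- intros r Hr. apply (Hsys r Hr).
        -- intros x Hx. apply (is_derive_opp (RInt g x0)).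
           apply (is_derive_RInt g (RInt g x0) x0 x).
           ++ apply filter_imp with (2 := proj2 (HD x Hx)). intros y Hy.
              apply (RInt_correct g). apply Hex. exact Hy.
           ++ apply (ex_derive_continuous g). eexists. apply (Hgl x Hx).
        -- intros x Hx. fold s. rewrite (Hor (s * ln x) (proj2 Hx)), Ha. ring.
      * exists (fun _ => 0). split.
        -- split; intros eta He; exfalso; apply HE; exists eta; exact He.
        -- intros eta He; exfalso; apply HE; exists eta; exact He.
    (* The definition of [Phi] solved for [Y]; then f = Y g^(p-1) / eta. *)
    + pose (Y := fun x => (- ((p - 1) * s / (p - 2)) * Phi (s * ln x) - ple_gamma p + n
                           + beta * (s ^ 2 * (p - 1) * Psi (s * ln x))) / alpha).
      pose (Q := fun x => Rpower (g x) (p - 1) * Rpower x (Ropp 1)).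
      exists (fun x => Q x * Y x).
      assert (HYQ : forall x, D x -> x * Rpower (g x) (1 - p) * (Q x * Y x) = Y x).
      { intros x Hx. unfold Q.
        transitivity (Rpower (g x) (1 - p) * Rpower (g x) (p - 1) * (x * Rpower x (Ropp 1)) * Y x);
          [ring|].
        rewrite <- Rpower_plus. replace (1 - p + (p - 1)) with 0 by ring.
        rewrite Rpower_O by apply Hg.
        rewrite Rpower_Ropp, Rpower_1 by apply (HD _ Hx).
        field. apply Rgt_not_eq, (HD _ Hx). }
      apply (ple_profile_of_slope p n alpha beta a0 b0 Phi Psi _ g Hp Hp2 Hn); auto.
      * intros r Hr. apply (Hsys r Hr).
      * intros x Hx. destruct (HD _ Hx) as [Hpos _].
        destruct (Hsys (s * ln x) (proj2 Hx)) as [HdPsi HdPhi].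
        assert (HQ : is_log_derive Q x
                  ((p - 1) * (/ (2 - p) * (Phi (s * ln x) * s / x + Ropp 2 * / x)) + Ropp 1 * / x)).
        { apply is_log_derive_mult.
          - apply (is_log_derive_Rpower g). apply Hgl. exact Hx.
          - apply (is_log_derive_Rpower (fun y => y)), is_log_derive_id; exact Hpos. }
        set (k := - ((p - 1) * s / (p - 2))).
        assert (HdY : is_derive Y x
          ((k * ((ple_c1 p * Phi (s * ln x) ^ 2 - ple_c2 p n beta * Psi (s * ln x) * Phi (s * ln x)
                 - ple_c3 p n * Phi (s * ln x) + ss_sgn ty * Psi (s * ln x) + sign (ple_b p n))
                * (s / x))
            + beta * (s ^ 2 * (p - 1)) * (Psi (s * ln x) * Phi (s * ln x) * (s / x))) / alpha)).
        { apply is_derive_ext with (fun y => (n - ple_gamma p) / alpha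
             + (k / alpha * Phi (s * ln y) + beta * (s ^ 2 * (p - 1)) / alpha * Psi (s * ln y))).
          - intros y. unfold Y. fold k. as_real_eq. field. exact Ha.
          - assert (H1 := is_derive_scal _ x (k / alpha) _ (is_derive_ln_coord Phi s x _ Hpos HdPhi)).
            assert (H2 := is_derive_scal _ x (beta * (s ^ 2 * (p - 1)) / alpha) _
                            (is_derive_ln_coord Psi s x _ Hpos HdPsi)).
            apply is_derive_eq with (1 := is_derive_plus _ _ x _ _
              (is_derive_const ((n - ple_gamma p) / alpha) x)
              (is_derive_plus _ _ x _ _ H1 H2)).
            unfold plus, zero; simpl. field. split; [lra | exact Ha]. }
        apply is_derive_eq with (1 := proj1 (is_derive_mult_iff _ _ _ _ _ HQ) HdY).
        assert (Eg : g x = Q x / x * (s ^ 2 * (p - 1) * Psi (s * ln x))).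
        { rewrite <- HX by exact Hx. unfold Q.
          rewrite Rpower_Ropp, Rpower_1 by exact Hpos.
          transitivity (Rpower (g x) (p - 1) * Rpower (g x) (2 - p)); [|field; lra].
          rewrite <- Rpower_plus. replace (p - 1 + (2 - p)) with 1 by ring.
          symmetry. apply Rpower_1, Hg. }
        rewrite Eg.
        assert (EPhi : Phi (s * ln x) = - ((p - 2) / ((p - 1) * s))
          * (ple_gamma p - n + alpha * Y x - beta * (s ^ 2 * (p - 1) * Psi (s * ln x)))).
        { unfold Y. field. repeat split; try lra; exact Ha. }
        assert (K := ple_rate_system ty p n alpha beta
                       (s ^ 2 * (p - 1) * Psi (s * ln x)) (Y x) Hp Hp2 Hn Hexp).
        cbv zeta in K. fold s in K. rewrite <- EPhi in K.
        replace (s ^ 2 * (p - 1) * Psi (s * ln x) / (s ^ 2 * (p - 1)))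
          with (Psi (s * ln x)) in K by (field; split; lra).
        rewrite <- K. rewrite EPhi. unfold k, ple_gamma.
        field. repeat split; try lra; exact Ha.
      * intros x Hx. fold s. rewrite HYQ by exact Hx. unfold Y.
        field. repeat split; try lra; exact Ha.
Qed.

(** [Psi] determines f', hence [f] up to a constant on an interval.  [Y] is the only place
    where [f] itself enters, and it is visible in [Phi] exactly when [alpha <> 0]. *)
Lemma ple_unique (p n alpha beta : R) (a0 b0 : Rbar) (f1 f2 : R -> R) :
  1 < p -> p <> 2 -> 0 < n ->
  let D := eta_dom (ple_scale p n) (Ioo a0 b0) in
  ple_profile_pos p n alpha beta D f1 -> ple_profile_pos p n alpha beta D f2 ->
  (forall eta, D eta ->
     ple_Phi p n alpha beta f1 eta = ple_Phi p n alpha beta f2 eta /\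
     ple_Psi p n f1 eta = ple_Psi p n f2 eta) ->
  exists k : R, (alpha <> 0 -> k = 0) /\ forall eta, D eta -> f1 eta = f2 eta + k.
Proof.
  intros Hp Hp2 Hn D H1 H2 HE.
  assert (HD : open_positive D) by apply eta_dom_open_positive.
  assert (Hn0 : n <> 0) by lra.
  assert (Hs : ple_scale p n <> 0) by (apply ple_scale_spec; exact Hn0).
  assert (Hs2 : 0 < ple_scale p n ^ 2) by (apply pow2_gt_0; exact Hs).
  assert (O1 := proj1 (ple_profile_pos_gradient_iff p n alpha beta D f1 HD Hp) H1).
  assert (O2 := proj1 (ple_profile_pos_gradient_iff p n alpha beta D f2 HD Hp) H2).
  assert (EX : forall x, D x -> ple_X p f1 x = ple_X p f2 x).
  { intros x Hx. destruct (HE x Hx) as [_ E]. unfold ple_Psi, Rdiv in E.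
    apply Rmult_eq_reg_r in E; [exact E|].
    apply Rgt_not_eq, Rinv_0_lt_compat, Rmult_lt_0_compat; lra. }
  assert (Eg : forall x, D x -> Derive f1 x = Derive f2 x).
  { intros x Hx. destruct (HD _ Hx) as [Hpos _].
    destruct (O1 x Hx) as [_ [G1 _]]. destruct (O2 x Hx) as [_ [G2 _]].
    assert (E := EX x Hx). rewrite !ple_X_eq in E by assumption.
    apply Rmult_eq_reg_l in E.
    2:{ apply Rgt_not_eq, Rmult_lt_0_compat; exact Hpos. }
    apply Rpower_inj in E; try assumption; lra. }
  destruct (Req_dec alpha 0) as [Ha|Ha].
  - destruct (classic (exists x, D x)) as [[x0 Hx0]|HN].
    + exists (f1 x0 - f2 x0). split; [contradiction|].
      assert (Hz : forall x, D x -> is_derive (fun y => f1 y - f2 y) x zero).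
      { intros x Hx. 
        apply is_derive_eq with (1 := is_derive_minus f1 f2 x _ _
          (Derive_correct _ _ (proj1 (O1 x Hx))) (Derive_correct _ _ (proj1 (O2 x Hx)))).
        rewrite Eg by exact Hx. unfold minus, plus, opp, zero; simpl. ring. }
      intros x Hx.
      enough (f1 x0 - f2 x0 = f1 x - f2 x) by lra.
      destruct (Rtotal_order x0 x) as [L|[->|L]]; [| reflexivity |].
      * apply (eq_is_derive (fun y => f1 y - f2 y)); [|exact L].
        intros z Hzz. apply Hz. apply (eta_dom_convex _ a0 b0 x0 x); assumption.
      * symmetry. apply (eq_is_derive (fun y => f1 y - f2 y)); [|exact L].
        intros z Hzz. apply Hz. apply (eta_dom_convex _ a0 b0 x x0); assumption.
    + exists 0. split; [reflexivity|]. intros x Hx. exfalso; apply HN; exists x; exact Hx.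
  - exists 0. split; [reflexivity|]. intros x Hx. rewrite Rplus_0_r.
    destruct (HD _ Hx) as [Hpos _].
    destruct (HE x Hx) as [E _]. unfold ple_Phi in E. rewrite EX in E by exact Hx.
    apply Rmult_eq_reg_l in E.
    2:{ apply Ropp_neq_0_compat. unfold Rdiv. apply Rmult_integral_contrapositive_currified.
        - lra.
        - apply Rinv_neq_0_compat, Rmult_integral_contrapositive_currified; [lra | exact Hs]. }
    assert (EY : alpha * ple_Y p f1 x = alpha * ple_Y p f2 x) by lra.
    apply Rmult_eq_reg_l in EY; [|exact Ha].
    destruct (O1 x Hx) as [_ [G1 _]]. destruct (O2 x Hx) as [_ [G2 _]].
    rewrite !ple_Y_eq in EY by assumption. rewrite Eg in EY by exact Hx.
    apply Rmult_eq_reg_l in EY; [exact EY|].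
    apply Rgt_not_eq, Rmult_lt_0_compat; [exact Hpos | apply Rpower_pos].
Qed.

(** * Translation of profiles *)

(** Keeps the class of intervals stable under the reversal of [r1]. *)
Lemma Ioo_reflect (eps : R) (a0 b0 : Rbar) : eps = 1 \/ eps = -1 ->
  exists a1 b1 : Rbar, forall r, Ioo a1 b1 r <-> Ioo a0 b0 (eps * r).
Proof.
  intros [-> | ->].
  - exists a0, b0. intros r. rewrite Rmult_1_l. reflexivity.
  - exists (Rbar_opp b0), (Rbar_opp a0). intros r.
    replace (-1 * r) with (- r) by ring.
    unfold Ioo. destruct a0, b0; simpl; split; intros [H1 H2]; split; auto; lra.
Qed.

(** Reversal of [r1] changes the sign of [Phi] and of the two coefficients that multiply an
    odd power of it. *)
Lemma solves_system_reflect (ty : ss_type) (c1 c2 c3 b b' eps : R)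
    (J J' : R -> Prop) (Phi Psi : R -> R) :
  eps * eps = 1 -> sign b = sign b' -> (forall r, J' r -> J (eps * r)) ->
  solves_system ty c1 c2 c3 b J Phi Psi ->
  solves_system ty c1 (eps * c2) (eps * c3) b' J'
    (fun r => eps * Phi (eps * r)) (fun r => Psi (eps * r)).
Proof.
  intros He Hb HJ H r Hr. destruct (H _ (HJ r Hr)) as [H1 H2].
  assert (Hlin : is_derive (fun r => eps * r) r eps).
  { auto_derive; [exact I | ring]. }
  split.
  - apply is_derive_eq with (1 := is_derive_comp Psi (fun r => eps * r) r _ _ H1 Hlin).
    unfold scal; simpl; unfold mult; simpl. ring.
  - apply is_derive_eq with (1 := is_derive_scal _ r eps _
      (is_derive_comp Phi (fun r => eps * r) r _ _ H2 Hlin)).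
    rewrite <- Hb. unfold scal; simpl; unfold mult; simpl.
    set (P := Phi (eps * r)). set (Q := Psi (eps * r)).
    transitivity (eps * eps * (c1 * P ^ 2 - c2 * Q * P - c3 * P + ss_sgn ty * Q + sign b));
      [ring|].
    transitivity (eps * eps * (c1 * P ^ 2 - c2 * Q * P - c3 * P) + (ss_sgn ty * Q + sign b));
      [rewrite He; ring | ring].
Qed.

Lemma solves_system_ext (ty : ss_type) (c1 c2 c3 b c1' c2' c3' : R)
    (J : R -> Prop) (Phi Psi : R -> R) :
  c1 = c1' -> c2 = c2' -> c3 = c3' ->
  solves_system ty c1 c2 c3 b J Phi Psi -> solves_system ty c1' c2' c3' b J Phi Psi.
Proof. intros -> -> ->; auto. Qed.

Lemma ple_profile_pos_sub (p n alpha beta : R) (D1 D2 : R -> Prop) (f : R -> R) :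
  (forall x, D2 x -> D1 x) ->
  ple_profile_pos p n alpha beta D1 f -> ple_profile_pos p n alpha beta D2 f.
Proof. intros H [H1 H2]; split; intros x Hx; auto. Qed.

(** Both directions go through the system: the profile is mapped to its trajectory, which
    is reversed if [eps = -1], and the trajectory is lifted to a profile of the other
    equation.  With [alpha' <> 0] every trajectory
    lifts to the PLE. *)
Lemma translation (ty : ss_type) (m n alpha beta p n' alpha' beta' eps : R) (a0 b0 : Rbar) :
  m <> 1 -> 0 < n -> (m - 1) * alpha + 2 * beta = ss_sgn ty ->
  1 < p -> p <> 2 -> 0 < n' -> (p - 2) * alpha' + p * beta' = ss_sgn ty ->
  eps = 1 \/ eps = -1 ->
  identified eps m n beta p n' beta' ->
  let J := Ioo a0 b0 in
  let D := eta_dom (pme_scale m n) J in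
  let D' := eta_dom (eps * ple_scale p n') J in
  (alpha' <> 0 ->
   forall f : R -> R, pme_profile m n alpha beta D f ->
     exists g : R -> R, ple_profile_pos p n' alpha' beta' D' g /\
       corresponding eps m n p n' alpha' beta' J f g) /\
  (forall g : R -> R, ple_profile_pos p n' alpha' beta' D' g ->
     exists f : R -> R, pme_profile m n alpha beta D f /\
       corresponding eps m n p n' alpha' beta' J f g).
Proof.
  intros Hm Hn Hexp Hp Hp2 Hn' Hexp' Heps (I1 & I2 & I3 & I4) J D D'.
  set (s := pme_scale m n) in *. set (s' := ple_scale p n') in *.
  assert (Hs : s <> 0) by apply pme_scale_spec.
  assert (Hs' : s' <> 0) by (apply ple_scale_spec; lra).
  assert (He : eps * eps = 1) by (destruct Heps as [-> | ->]; ring).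
  assert (Hee : forall z, eps * (eps * z) = z).
  { intros z. rewrite <- Rmult_assoc, He. ring. }
  destruct (Ioo_reflect eps a0 b0 Heps) as (a1 & b1 & HJ).
  assert (HD' : forall x, D' x <-> eta_dom s' (Ioo a1 b1) x).
  { intros x. unfold D', eta_dom. rewrite HJ, Rmult_assoc. reflexivity. }
  split.
  - intros Ha f Hf.
    destruct (pme_to_system ty m n alpha beta a0 b0 f Hm Hn Hexp Hf) as [Hpos Hsys].
    fold s in Hpos, Hsys.
    assert (Hsys' := solves_system_reflect ty _ _ _ _ _ eps _ (Ioo a1 b1) _ _
                       He I4 (fun r => proj1 (HJ r)) Hsys).
    apply (solves_system_ext ty _ _ _ _ (ple_c1 p) (ple_c2 p n' beta') (ple_c3 p n')) in Hsys'.
    2: exact I1. 2: rewrite I2; apply Hee. 2: rewrite I3; apply Hee.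
    destruct (proj2 (ple_of_system ty p n' alpha' beta' a1 b1 _ _ Hp Hp2 Hn' Hexp' Hsys'
      (fun r Hr => Hpos _ (proj2 (eta_dom_exp s J (eps * r) Hs) (proj1 (HJ r) Hr))))
      (or_introl Ha)) as [g [Hg Hgf]].
    exists g. split.
    + apply (ple_profile_pos_sub p n' alpha' beta' _ D' g (fun x => proj1 (HD' x)) Hg).
    + intros r Hr. cbv zeta. fold s s'.
      assert (Hr' : eta_dom s' (Ioo a1 b1) (exp (eps * r / s'))).
      { apply eta_dom_exp; [exact Hs'|]. apply HJ. rewrite Hee. exact Hr. }
      destruct (Hgf _ Hr') as [G1 G2]. fold s' in G1, G2.
      rewrite ln_exp in G1, G2.
      replace (s' * (eps * r / s')) with (eps * r) in G1, G2 by (field; exact Hs').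
      rewrite Hee in G1, G2. split; assumption.
  - intros g Hg.
    apply (ple_profile_pos_sub p n' alpha' beta' D' (eta_dom s' (Ioo a1 b1)) g
             (fun x => proj2 (HD' x))) in Hg.
    destruct (ple_to_system ty p n' alpha' beta' a1 b1 g Hp Hp2 Hn' Hexp' Hg) as [Hpos Hsys].
    fold s' in Hpos, Hsys.
    assert (HJ' : forall r, J r -> Ioo a1 b1 (eps * r)).
    { intros r Hr. apply HJ. rewrite Hee. exact Hr. }
    assert (Hsys' := solves_system_reflect ty _ _ _ _ _ eps _ J _ _
                       He (eq_sym I4) HJ' Hsys).
    apply (solves_system_ext ty _ _ _ _ (pme_c1 m) (pme_c2 m n beta) (pme_c3 m n)) in Hsys'.
    2: now symmetry. 2: now rewrite I2. 2: now rewrite I3.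
    destruct (pme_of_system ty m n alpha beta a0 b0 _ _ Hm Hn Hexp Hsys'
      (fun r Hr => Hpos _ (proj2 (eta_dom_exp s' (Ioo a1 b1) (eps * r) Hs') (HJ' r Hr))))
      as [f [Hf Hfg]].
    exists f. split; [exact Hf|].
    intros r Hr. cbv zeta. fold s s'.
    assert (Hr' : eta_dom s J (exp (r / s))) by (apply eta_dom_exp; assumption).
    destruct (Hfg _ Hr') as [G1 G2]. fold s in G1, G2.
    rewrite ln_exp in G1, G2.
    replace (s * (r / s)) with r in G1, G2 by (field; exact Hs).
    rewrite G1, G2, Hee. split; reflexivity.
Qed.

(** * Which parameters give identified systems *)

(** The square root of |b|, up to a factor depending only on [m], as a function of the
    normalized distance from criticality.  The value at 0 makes the replacements n - 2 and
    n of the critical cases follow the same formula. *)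
Definition unit_scale (m x : R) : R :=
  if Req_EM_T x 0 then / (1 - m) else sqrt (Rabs x / (m * Rabs (m - 1))).

(** This is n (m - m_c) / (2 m). *)
Definition pme_ratio (m n : R) : R := (n * (m - 1) + 2) / (2 * m).
(** This is (n + 1) (p - p_c) / p for p = m + 1. *)
Definition ple_ratio (m n : R) : R := (n * (m - 1) + m + 1) / (m + 1).

Lemma unit_scale_neq_0 (m x : R) : 0 < m -> m <> 1 -> unit_scale m x <> 0.
Proof.
  intros Hm Hm1. unfold unit_scale. destruct (Req_EM_T x 0) as [E|E].
  - apply Rinv_neq_0_compat. lra.
  - apply Rgt_not_eq, sqrt_lt_R0, Rdiv_lt_0_compat; [apply Rabs_pos_lt, E|].
    apply Rmult_lt_0_compat; [exact Hm | apply Rabs_pos_lt; lra].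
Qed.

Lemma sqrt_scaled (k z : R) : 0 <= k -> 0 <= z -> sqrt (k * k * z) = k * sqrt z.
Proof.
  intros Hk Hz. rewrite sqrt_mult by (try assumption; now apply Rmult_le_pos).
  rewrite sqrt_square by exact Hk. reflexivity.
Qed.

Lemma unit_scale_arg_pos (m x : R) : 0 < m -> m <> 1 -> 0 <= Rabs x / (m * Rabs (m - 1)).
Proof.
  intros Hm Hm1. apply Rmult_le_pos; [apply Rabs_pos|].
  apply Rlt_le, Rinv_0_lt_compat, Rmult_lt_0_compat; [exact Hm | apply Rabs_pos_lt; lra].
Qed.

Lemma pme_b_ratio (m n : R) : 0 < m -> m <> 1 -> n <> 0 ->
  pme_b m n = 4 * m * pme_ratio m n / (m - 1).
Proof. intros. unfold pme_b, pme_mc, pme_ratio. field. repeat split; lra. Qed.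

Lemma ple_b_ratio (m n : R) : 0 < m -> m <> 1 -> n <> -1 ->
  ple_b (m + 1) n = (m + 1) ^ 2 * ple_ratio m n / (m * (m - 1)).
Proof. intros. unfold ple_b, ple_pc, ple_ratio. field. repeat split; lra. Qed.

(** In the critical case n (m - 1) = -2, so that the scale n - 2 = n m is
    2 m / (1 - m); it does not vanish because [0 < m]. *)
Lemma pme_scale_ratio (m n : R) : 0 < m -> m <> 1 -> n <> 0 ->
  pme_scale m n = 2 * m * unit_scale m (pme_ratio m n).
Proof.
  intros Hm Hm1 Hn. unfold pme_scale, unit_scale.
  assert (Hb := pme_b_ratio m n Hm Hm1 Hn).
  assert (Ham : 0 < Rabs (m - 1)) by (apply Rabs_pos_lt; lra).
  assert (Hx : n * (m - 1) + 2 = 2 * m * pme_ratio m n) by (unfold pme_ratio; field; lra).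
  set (x := pme_ratio m n) in *.
  destruct (Req_EM_T (pme_b m n) 0) as [E|E]; destruct (Req_EM_T x 0) as [E'|E'].
  - rewrite E', Rmult_0_r in Hx.
    assert (Hn2 : n = - 2 / (m - 1)).
    { apply Rmult_eq_reg_r with (m - 1); [|lra].
      transitivity (-2); [lra | field; lra]. }
    destruct (Req_EM_T n 2) as [E2|E2].
    + exfalso. rewrite E2 in Hx. lra.
    + rewrite Hn2. field. lra.
  - exfalso. apply E'. rewrite Hb in E. unfold Rdiv in E.
    apply Rmult_integral in E. destruct E as [E|E].
    + apply Rmult_integral in E. destruct E as [E|E]; [lra | exact E].
    + exfalso; revert E. apply Rinv_neq_0_compat. lra.
  - exfalso. apply E. rewrite Hb, E'. unfold Rdiv. ring.
  - rewrite <- sqrt_scaled; [|lra | apply unit_scale_arg_pos; assumption].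
    f_equal. rewrite Hb. unfold Rdiv.
    rewrite Rabs_mult, Rabs_inv, Rabs_mult, (Rabs_right (4 * m)) by lra.
    field. lra.
Qed.

(** In the critical case n (m - 1) = -(m + 1), so that the scale n is (m + 1) / (1 - m). *)
Lemma ple_scale_ratio (m n : R) : 0 < m -> m <> 1 -> n <> -1 ->
  ple_scale (m + 1) n = (m + 1) * unit_scale m (ple_ratio m n).
Proof.
  intros Hm Hm1 Hn. unfold ple_scale, unit_scale.
  assert (Hb := ple_b_ratio m n Hm Hm1 Hn).
  assert (Ham : 0 < Rabs (m - 1)) by (apply Rabs_pos_lt; lra).
  assert (Hx : n * (m - 1) + m + 1 = (m + 1) * ple_ratio m n) by (unfold ple_ratio; field; lra).
  set (x := ple_ratio m n) in *.
  destruct (Req_EM_T (ple_b (m + 1) n) 0) as [E|E]; destruct (Req_EM_T x 0) as [E'|E'].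
  - rewrite E', Rmult_0_r in Hx.
    apply Rmult_eq_reg_r with (m - 1); [|lra].
    transitivity (- (m + 1)); [lra | field; lra].
  - exfalso. apply E'. rewrite Hb in E. unfold Rdiv in E.
    apply Rmult_integral in E. destruct E as [E|E].
    + apply Rmult_integral in E. destruct E as [E|E]; [|exact E].
      exfalso; revert E. apply pow_nonzero. lra.
    + exfalso; revert E. apply Rinv_neq_0_compat, Rmult_integral_contrapositive_currified; lra.
  - exfalso. apply E. rewrite Hb, E'. unfold Rdiv. ring.
  - rewrite <- sqrt_scaled; [|lra | apply unit_scale_arg_pos; assumption].
    f_equal. rewrite Hb. unfold Rdiv.
    rewrite Rabs_mult, Rabs_inv, !Rabs_mult, (Rabs_right m) by lra.
    rewrite (Rabs_right ((m + 1) ^ 2)) by (apply Rle_ge, pow2_ge_0).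
    field. lra.
Qed.

Lemma sign_mult_pos (k x : R) : 0 < k -> sign (k * x) = sign x.
Proof. intros Hk. rewrite sign_mult, (sign_eq_1 k Hk). ring. Qed.

(** Both [b] have the sign of the ratio times the sign of m - 1. *)
Lemma sign_b_iff (m n n' : R) : 0 < m -> m <> 1 -> n <> 0 -> n' <> -1 ->
  (sign (pme_b m n) = sign (ple_b (m + 1) n') <-> sign (pme_ratio m n) = sign (ple_ratio m n')).
Proof.
  intros Hm Hm1 Hn Hn'. rewrite pme_b_ratio, ple_b_ratio by assumption.
  set (x := pme_ratio m n). set (y := ple_ratio m n').
  replace (4 * m * x / (m - 1)) with ((4 * m) * (x * / (m - 1))) by (field; lra).
  replace ((m + 1) ^ 2 * y / (m * (m - 1))) with (((m + 1) ^ 2 / m) * (y * / (m - 1)))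
    by (field; lra).
  assert (Hk : 0 < (m + 1) ^ 2 / m).
  { apply Rdiv_lt_0_compat; [apply pow2_gt_0; lra | exact Hm]. }
  rewrite (sign_mult_pos (4 * m)) by lra.
  rewrite (sign_mult_pos ((m + 1) ^ 2 / m)) by exact Hk.
  rewrite !sign_mult. split; [|intros ->; reflexivity].
  intros H. apply Rmult_eq_reg_r in H; [exact H|].
  assert (Hi : / (m - 1) <> 0) by (apply Rinv_neq_0_compat; lra).
  destruct (Rtotal_order (/ (m - 1)) 0) as [L|[L|L]]; [|tauto|].
  - rewrite sign_eq_m1 by exact L. lra.
  - rewrite sign_eq_1 by exact L. lra.
Qed.

Lemma sign_same_cases (x y : R) : sign x = sign y ->
  (x = 0 /\ y = 0) \/ (0 < x /\ 0 < y) \/ (x < 0 /\ y < 0).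
Proof.
  destruct (Rtotal_order x 0) as [Lx|[->|Lx]]; destruct (Rtotal_order y 0) as [Ly|[->|Ly]];
    rewrite ?sign_0, ?(sign_eq_1 x), ?(sign_eq_1 y), ?(sign_eq_m1 x), ?(sign_eq_m1 y)
      by assumption; try tauto; intros; lra.
Qed.

(** The quotient of the two values is sqrt (|y| / |x|), and |y| / |x| = |y|^2 when x y = 1. *)
Lemma unit_scale_inv (m x y : R) : 0 < m -> m <> 1 -> x * y = 1 ->
  unit_scale m y = Rabs y * unit_scale m x.
Proof.
  intros Hm Hm1 Hxy.
  assert (Hx : x <> 0) by (intros ->; lra). assert (Hy : y <> 0) by (intros ->; lra).
  unfold unit_scale. destruct (Req_EM_T x 0); [contradiction|].
  destruct (Req_EM_T y 0); [contradiction|].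
  rewrite <- sqrt_scaled; [|apply Rabs_pos | apply unit_scale_arg_pos; assumption].
  f_equal.
  assert (E : Rabs x * Rabs y = 1) by (rewrite <- Rabs_mult, Hxy; apply Rabs_R1).
  unfold Rdiv. transitivity (Rabs x * Rabs y * Rabs y * / (m * Rabs (m - 1))).
  - rewrite E. ring.
  - ring.
Qed.

Lemma unit_scale_pos (m x : R) : 0 < m -> m <> 1 -> x <> 0 -> 0 < unit_scale m x.
Proof.
  intros Hm Hm1 Hx. assert (H := unit_scale_neq_0 m x Hm Hm1).
  unfold unit_scale in *. destruct (Req_EM_T x 0); [contradiction|].
  assert (K := sqrt_pos (Rabs x / (m * Rabs (m - 1)))). lra.
Qed.

Lemma unit_scale_sqr (m x : R) : 0 < m -> m <> 1 -> x <> 0 ->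
  unit_scale m x * unit_scale m x = Rabs x / (m * Rabs (m - 1)).
Proof.
  intros Hm Hm1 Hx. unfold unit_scale. destruct (Req_EM_T x 0); [contradiction|].
  apply sqrt_sqrt, unit_scale_arg_pos; assumption.
Qed.

(** Squaring the balance of the [c3] and using the equality of the signs gives
    (x - y) (x y - 1) = 0.  Undoing the square fixes [eps]: it is 1 when y = x, and the
    common sign of [x] and [y] when x y = 1.  At x = y = -1 both [c3] vanish and [eps]
    is free, but this point lies on both branches. *)
Lemma unit_scale_balance (m x y eps : R) : 0 < m -> m <> 1 -> eps = 1 \/ eps = -1 ->
  ((sign x = sign y /\ (x + 1) * unit_scale m y = eps * (y + 1) * unit_scale m x) <->
   (eps = 1 /\ y = x) \/ (x * y = 1 /\ 0 < eps * x)).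
Proof.
  intros Hm Hm1 Heps. split.
  - intros [Hs Hb].
    destruct (Req_dec x 0) as [Ex|Ex].
    { apply sign_same_cases in Hs. assert (Ey : y = 0) by lra.
      rewrite Ex, Ey in Hb. left. split; [|lra].
      assert (K := unit_scale_neq_0 m 0 Hm Hm1).
      apply Rmult_eq_reg_r with (unit_scale m 0); lra. }
    assert (Hxy : 0 < x /\ 0 < y \/ x < 0 /\ y < 0).
    { apply sign_same_cases in Hs. tauto. }
    assert (Ey : y <> 0) by lra.
    assert (Hux := unit_scale_pos m x Hm Hm1 Ex). assert (Huy := unit_scale_pos m y Hm Hm1 Ey).
    assert (Sx := unit_scale_sqr m x Hm Hm1 Ex). assert (Sy := unit_scale_sqr m y Hm Hm1 Ey).
    set (u := unit_scale m x) in *. set (v := unit_scale m y) in *.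
    assert (Hk : 0 < m * Rabs (m - 1)).
    { apply Rmult_lt_0_compat; [exact Hm | apply Rabs_pos_lt; lra]. }
    assert (Ham : 0 < Rabs (m - 1)) by (apply Rabs_pos_lt; lra).
    assert (Sq : (x + 1) ^ 2 * Rabs y = (y + 1) ^ 2 * Rabs x).
    { replace (Rabs x) with (u * u * (m * Rabs (m - 1))) by (rewrite Sx; field; lra).
      replace (Rabs y) with (v * v * (m * Rabs (m - 1))) by (rewrite Sy; field; lra).
      transitivity (((x + 1) * v) * ((x + 1) * v) * (m * Rabs (m - 1))); [ring|].
      rewrite Hb. destruct Heps as [-> | ->]; ring. }
    (* By the common sign the absolute values drop out of [Sq]. *)
    assert (Fac : (x - y) * (x * y - 1) = 0).
    { destruct Hxy as [[H1 H2]|[H1 H2]].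
      - rewrite !Rabs_right in Sq by lra. 
        transitivity ((x + 1) ^ 2 * y - (y + 1) ^ 2 * x); [ring | lra].
      - rewrite !Rabs_left in Sq by lra. 
        transitivity ((y + 1) ^ 2 * - x - (x + 1) ^ 2 * - y); [ring | lra]. }
    destruct (Req_dec x (-1)) as [E1|E1].
    + assert (y = -1).
      { rewrite E1 in Hb.
        assert (Hz : (y + 1) * (eps * u) = 0) by lra.
        apply Rmult_integral in Hz. destruct Hz as [Hz|Hz]; [lra|].
        exfalso. destruct Heps as [-> | ->]; lra. }
      destruct Heps as [-> | ->]; [left | right]; split; subst; lra.
    + apply Rmult_integral in Fac. destruct Fac as [F|F].
      * left. assert (y = x) by lra. subst y. split; [|reflexivity].
        unfold v in Hb. fold u in Hb.
        destruct Heps as [-> | ->]; [reflexivity|].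
        exfalso. assert (Hz : (x + 1) * u = 0) by lra.
        apply Rmult_integral in Hz. lra.
      * right. assert (Hp : x * y = 1) by lra. split; [exact Hp|].
        assert (Hz : (x + 1) * (x * v - eps * u) = 0).
        { transitivity (x * ((x + 1) * v) - eps * u * (x + x * y)); [|rewrite Hb; ring].
          rewrite Hp. ring. }
        apply Rmult_integral in Hz. destruct Hz as [Hz|Hz]; [lra|].
        destruct Heps as [-> | ->].
        -- destruct (Rlt_le_dec 0 x) as [L|L]; [lra|]. exfalso.
           assert (x * v <= 0 * v) by (apply Rmult_le_compat_r; lra). lra.
        -- destruct (Rlt_le_dec x 0) as [L|L]; [lra|]. exfalso.
           assert (0 * v <= x * v) by (apply Rmult_le_compat_r; lra). lra.
  - intros [[-> ->]|[Hxy He]]; [split; [reflexivity | ring]|].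
    rewrite (unit_scale_inv m x y Hm Hm1 Hxy).
    assert (Hy : y = / x).
    { assert (x <> 0) by (intros ->; lra).
      apply Rmult_eq_reg_l with x; [|assumption]. rewrite Hxy. field. assumption. }
    destruct Heps as [-> | ->].
    + assert (Hx0 : 0 < x) by lra.
      assert (Hy0 : 0 < y) by (rewrite Hy; apply Rinv_0_lt_compat; exact Hx0).
      split; [rewrite !sign_eq_1 by assumption; reflexivity|].
      rewrite Rabs_right by lra.
      transitivity ((x * y + y) * unit_scale m x); [ring|]. rewrite Hxy. ring.
    + assert (Hx0 : x < 0) by lra.
      assert (Hy0 : y < 0) by (rewrite Hy; apply Rinv_lt_0_compat; exact Hx0).
      split; [rewrite !sign_eq_m1 by assumption; reflexivity|].
      rewrite Rabs_left by lra.
      transitivity (- (x * y + y) * unit_scale m x); [ring|]. rewrite Hxy. ring.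
Qed.

Lemma c1_eq_iff (m p : R) : m <> 1 -> p <> 2 ->
  (pme_c1 m = ple_c1 p <-> p = m + 1).
Proof.
  intros Hm Hp. unfold pme_c1, ple_c1. split.
  - intros H. 
    assert (E : m * (p - 2) = (p - 1) * (m - 1)).
    { transitivity (m / (m - 1) * ((m - 1) * (p - 2))); [field; lra|].
      rewrite H. field. lra. }
    lra.
  - intros ->. f_equal; ring.
Qed.

(** The two options in symmetric form.  The last equation on each branch is the equality of
    the [c2]: the quotient of the two unit scales is 1 on the first branch and |y| on the second
    one, where [eps * Rabs y = y]. *)
Lemma identified_iff (eps m n beta n' beta' : R) :
  0 < m -> m <> 1 -> n <> 0 -> n <> -2 -> n' <> -1 -> n' <> -2 ->
  eps = 1 \/ eps = -1 ->
  let x := pme_ratio m n in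
  let y := ple_ratio m n' in
  (identified eps m n beta (m + 1) n' beta' <->
   (eps = 1 /\ y = x /\ (m + 1) * beta' = 2 * m * beta) \/
   (x * y = 1 /\ 0 < eps * x /\ (m + 1) * beta' = 2 * m * x * beta)).
Proof.
  intros Hm Hm1 Hn Hn2 Hn' Hn2' Heps x y.
  assert (Hm0 : m <> 0) by lra. assert (Hd : m - 1 <> 0) by lra.
  assert (Hp : m + 1 <> 0) by lra. assert (Hp2 : m + 1 <> 2) by lra.
  assert (Hd2 : m + 1 - 2 <> 0) by lra.
  assert (Sp := pme_scale_ratio m n Hm Hm1 Hn). assert (Sq := ple_scale_ratio m n' Hm Hm1 Hn').
  assert (Bal := unit_scale_balance m x y eps Hm Hm1 Heps).
  assert (Hu := unit_scale_neq_0 m x Hm Hm1). assert (Hv := unit_scale_neq_0 m y Hm Hm1).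
  assert (Hq : ple_scale (m + 1) n' <> 0).
  { rewrite Sq. apply Rmult_integral_contrapositive_currified; assumption. }
  assert (C3 : pme_c3 m n = eps * ple_c3 (m + 1) n' <->
               (x + 1) * unit_scale m y = eps * (y + 1) * unit_scale m x).
  { rewrite pme_c3_mul, ple_c3_mul by assumption.
    rewrite Sp, Sq. fold x y. set (u := unit_scale m x) in *. set (v := unit_scale m y) in *.
    replace ((n * (m - 1) + 2 + 2 * m) / ((m - 1) * (2 * m * u)))
      with ((x + 1) * v / ((m - 1) * u * v))
      by (unfold x, pme_ratio; field; repeat split; assumption).
    replace (eps * ((m + 1 + n' * (m + 1 - 2) + (m + 1)) / ((m + 1 - 2) * ((m + 1) * v))))
      with (eps * (y + 1) * u / ((m - 1) * u * v))
      by (unfold y, ple_ratio; field; repeat split; assumption).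
    split; [|intros ->; reflexivity].
    intros H. apply Rmult_eq_reg_r in H; [exact H|].
    apply Rinv_neq_0_compat. repeat apply Rmult_integral_contrapositive_currified;
      assumption. }
  assert (C2 : pme_c2 m n beta = eps * ple_c2 (m + 1) n' beta' <->
               2 * m * beta * unit_scale m x = eps * ((m + 1) * beta') * unit_scale m y).
  { unfold pme_c2, ple_c2. rewrite Sp, Sq. fold x y.
    replace (beta * (2 * m * unit_scale m x)) with (2 * m * beta * unit_scale m x) by ring.
    replace (eps * (beta' * ((m + 1) * unit_scale m y)))
      with (eps * ((m + 1) * beta') * unit_scale m y) by ring.
    reflexivity. }
  assert (SB := sign_b_iff m n n' Hm Hm1 Hn Hn'). fold x y in SB.
  assert (Opt2 : x * y = 1 -> 0 < eps * x ->
     (2 * m * beta * unit_scale m x = eps * ((m + 1) * beta') * unit_scale m y <->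
      (m + 1) * beta' = 2 * m * x * beta)).
  { intros Hxy He. rewrite (unit_scale_inv m x y Hm Hm1 Hxy).
    replace (eps * ((m + 1) * beta') * (Rabs y * unit_scale m x))
      with (y * ((m + 1) * beta') * unit_scale m x).
    2:{ assert (Ha : eps * Rabs y = y).
        { clear - Hxy He Heps. clearbody x y. destruct Heps as [-> | ->].
          - rewrite Rabs_right; [ring|]. 
            destruct (Rlt_le_dec y 0) as [L|L]; [|lra]. exfalso.
            assert (x * y < x * 0) by (apply Rmult_lt_compat_l; lra). lra.
          - rewrite Rabs_left1; [ring|].
            destruct (Rlt_le_dec 0 y) as [L|L]; [|lra]. exfalso.
            assert (x * y < 0 * y) by (apply Rmult_lt_compat_r; lra). lra. }
        rewrite <- Ha at 1. ring. }
    split; intros H.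
    - apply Rmult_eq_reg_r in H; [|exact Hu].
      transitivity (x * y * ((m + 1) * beta')); [rewrite Hxy; ring|].
      transitivity (x * (2 * m * beta)); [rewrite H; ring | ring].
    - rewrite H. transitivity (x * y * (2 * m * beta * unit_scale m x));
        [rewrite Hxy; ring | ring]. }
  unfold identified. split.
  - intros (_ & H2 & H3 & H4).
    apply C2 in H2. apply C3 in H3. apply SB in H4.
    destruct (proj1 Bal (conj H4 H3)) as [[E1 E2]|[E1 E2]]; [left | right].
    + split; [exact E1 | split; [exact E2|]]. rewrite E1, E2 in H2.
      apply Rmult_eq_reg_r with (unit_scale m x); [|exact Hu].
      rewrite H2. ring.
    + split; [exact E1 | split; [exact E2|]]. apply Opt2; assumption.
  - intros H.
    assert (K : (eps = 1 /\ y = x) \/ (x * y = 1 /\ 0 < eps * x)) by tauto.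
    destruct (proj2 Bal K) as [H4 H3].
    split; [apply c1_eq_iff; [assumption | assumption | reflexivity] | split; [apply C2 | split; [apply C3; exact H3 | apply SB; exact H4]]].
    destruct H as [(E1 & E2 & E3)|(E1 & E2 & E3)].
    + rewrite E1, E2, E3. ring.
    + apply Opt2; assumption.
Qed.

Lemma pme_mc_gap (m n : R) : n <> 0 -> n * (m - 1) + 2 = n * (m - pme_mc n).
Proof. intros. unfold pme_mc. field. assumption. Qed.

Lemma ple_pc_gap (p n : R) : n <> -1 -> n * (p - 2) + p = (n + 1) * (p - ple_pc n).
Proof. intros. unfold ple_pc. field. lra. Qed.

Lemma scaled_pos_iff (k z : R) : 0 < k -> (0 < k * z <-> 0 < z).
Proof.
  intros Hk. split; intros H.
  - apply Rmult_lt_reg_l with k; lra.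
  - apply Rmult_lt_0_compat; assumption.
Qed.

Lemma pme_mc_lt_iff (m n : R) : 0 < n -> (pme_mc n < m <-> 0 < n * (m - 1) + 2).
Proof.
  intros Hn. rewrite pme_mc_gap by lra. rewrite scaled_pos_iff by exact Hn.
  split; intros; lra.
Qed.

Lemma pme_mc_gt_iff (m n : R) : 0 < n -> (m < pme_mc n <-> 0 < - (n * (m - 1) + 2)).
Proof.
  intros Hn. rewrite pme_mc_gap by lra.
  replace (- (n * (m - pme_mc n))) with (n * (pme_mc n - m)) by ring.
  rewrite scaled_pos_iff by exact Hn. split; intros; lra.
Qed.

Lemma ple_pc_lt_iff (p n : R) : 0 < n -> (ple_pc n < p <-> 0 < n * (p - 2) + p).
Proof.
  intros Hn. rewrite ple_pc_gap by lra. rewrite scaled_pos_iff by lra.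
  split; intros; lra.
Qed.

Lemma ple_pc_gt_iff (p n : R) : 0 < n -> (p < ple_pc n <-> 0 < - (n * (p - 2) + p)).
Proof.
  intros Hn. rewrite ple_pc_gap by lra.
  replace (- ((n + 1) * (p - ple_pc n))) with ((n + 1) * (ple_pc n - p)) by ring.
  rewrite scaled_pos_iff by lra. split; intros; lra.
Qed.

Lemma eq_mul_iff (k a b : R) : k <> 0 -> (k * a = k * b <-> a = b).
Proof.
  intros Hk. split; [|intros ->; reflexivity]. intros H.
  apply Rmult_eq_reg_l in H; assumption.
Qed.

Lemma pme_ms_iff (m n : R) : 0 < n -> (m = pme_ms n <-> n * (m - 1) + 2 + 2 * m = 0).
Proof.
  intros Hn. replace (n * (m - 1) + 2 + 2 * m) with ((n + 2) * (m - pme_ms n)).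
  - split; [intros H; rewrite <- H; ring|]. intros H.
    apply Rmult_integral in H. lra.
  - unfold pme_ms. field. lra.
Qed.

Lemma ple_ps_iff (p n : R) : 0 < n -> (p = ple_ps n <-> n * (p - 2) + 2 * p = 0).
Proof.
  intros Hn. replace (n * (p - 2) + 2 * p) with ((n + 2) * (p - ple_ps n)).
  - split; [intros H; rewrite <- H; ring|]. intros H.
    apply Rmult_integral in H. lra.
  - unfold ple_ps. field. lra.
Qed.

(** If n' = n, both branches become polynomial equations divisible by m - 1 and by the
    numerator n (m - 1) + 2 + 2 m of [c3], and the second one has the further factor n - 1. *)
Lemma dimension_changes (m n beta p beta' eps : R) :
  m <> 1 -> 0 < n -> 1 < p -> p <> 2 -> eps = 1 \/ eps = -1 ->
  identified eps m n beta p n beta' -> n = 1 \/ m = pme_ms n.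
Proof.
  intros Hm Hn Hp Hp2 Heps H.
  assert (E : p = m + 1) by (apply c1_eq_iff; try assumption; apply H).
  subst p. assert (Hm0 : 0 < m) by lra.
  apply identified_iff in H; try assumption; try lra.
  assert (K : (n - 1) * (n * (m - 1) + 2 + 2 * m) = 0).
  { apply Rmult_eq_reg_l with (m - 1); [|lra]. rewrite Rmult_0_r.
    destruct H as [(_ & H & _)|(H & _)].
    - unfold ple_ratio, pme_ratio in H.
      assert (H' : (m - 1) * (n * (m - 1) + 2 + 2 * m) = 0).
      { transitivity (((n * (m - 1) + m + 1) / (m + 1) - (n * (m - 1) + 2) / (2 * m))
                      * (2 * m * (m + 1))); [field; lra | rewrite H; ring]. }
      transitivity ((n - 1) * ((m - 1) * (n * (m - 1) + 2 + 2 * m))); [ring|].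
      rewrite H'. ring.
    - unfold ple_ratio, pme_ratio in H.
      transitivity (((n * (m - 1) + 2) / (2 * m) * ((n * (m - 1) + m + 1) / (m + 1)) - 1)
                      * (2 * m * (m + 1))); [field; lra | rewrite H; ring]. }
  apply Rmult_integral in K. destruct K as [K|K]; [left; lra | right].
  apply pme_ms_iff; assumption.
Qed.

Lemma same_branch_to_ple (m n n' : R) : 0 < m -> m <> 1 ->
  (ple_ratio m n' = pme_ratio m n <-> n' = to_ple_dim1 m n).
Proof.
  intros Hm Hm1. unfold ple_ratio, pme_ratio, to_ple_dim1.
  rewrite <- (eq_mul_iff (m - 1) n') by lra.
  rewrite <- (eq_mul_iff (m + 1) ((n' * (m - 1) + m + 1) / (m + 1))) by lra.
  replace ((m + 1) * ((n' * (m - 1) + m + 1) / (m + 1))) with (n' * (m - 1) + m + 1)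
    by (field; lra).
  replace ((m - 1) * ((m + 1) * (n - 2) / (2 * m)))
    with ((m + 1) * ((n * (m - 1) + 2) / (2 * m)) - (m + 1)) by (field; lra).
  split; intros; lra.
Qed.

Lemma same_branch_to_pme (m n n' : R) : 0 < m -> m <> 1 ->
  (ple_ratio m n' = pme_ratio m n <-> n = to_pme_dim1 (m + 1) n').
Proof.
  intros Hm Hm1. unfold ple_ratio, pme_ratio, to_pme_dim1.
  rewrite <- (eq_mul_iff (m - 1) n) by lra.
  rewrite <- (eq_mul_iff (2 * m) ((n' * (m - 1) + m + 1) / (m + 1))) by lra.
  replace (2 * m * ((n * (m - 1) + 2) / (2 * m))) with (n * (m - 1) + 2)
    by (field; lra).
  replace ((m - 1) * (2 + 2 * (m + 1 - 1) * n' / (m + 1)))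
    with (2 * m * ((n' * (m - 1) + m + 1) / (m + 1)) - 2) by (field; lra).
  split; intros; lra.
Qed.

Lemma inverse_branch_to_ple (m n n' : R) : 0 < m -> m <> 1 -> n * (m - 1) + 2 <> 0 ->
  (pme_ratio m n * ple_ratio m n' = 1 <-> n' = to_ple_dim2 m n).
Proof.
  intros Hm Hm1 HB. unfold ple_ratio, pme_ratio, to_ple_dim2.
  replace (2 + n * (m - 1)) with (n * (m - 1) + 2) by ring.
  rewrite <- (eq_mul_iff ((m - 1) * (n * (m - 1) + 2)) n')
    by (apply Rmult_integral_contrapositive_currified; lra).
  rewrite <- (eq_mul_iff (2 * m * (m + 1)) _ 1)
    by (repeat apply Rmult_integral_contrapositive_currified; lra).
  replace (2 * m * (m + 1) * ((n * (m - 1) + 2) / (2 * m) * ((n' * (m - 1) + m + 1) / (m + 1))))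
    with ((m - 1) * (n * (m - 1) + 2) * n' + (n * (m - 1) + 2) * (m + 1)) by (field; lra).
  replace ((m - 1) * (n * (m - 1) + 2) * ((m + 1) * (2 - n) / (n * (m - 1) + 2)))
    with (2 * m * (m + 1) - (n * (m - 1) + 2) * (m + 1)) by (field; exact HB).
  split; intros; lra.
Qed.

Lemma inverse_branch_to_pme (m n n' : R) : 0 < m -> m <> 1 -> n' * (m - 1) + m + 1 <> 0 ->
  (pme_ratio m n * ple_ratio m n' = 1 <-> n = to_pme_dim2 (m + 1) n').
Proof.
  intros Hm Hm1 HB. unfold ple_ratio, pme_ratio, to_pme_dim2.
  replace (m + 1 + n' * (m + 1 - 2)) with (n' * (m - 1) + m + 1) by ring.
  rewrite <- (eq_mul_iff ((m - 1) * (n' * (m - 1) + m + 1)) n)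
    by (apply Rmult_integral_contrapositive_currified; lra).
  rewrite <- (eq_mul_iff (2 * m * (m + 1)) _ 1)
    by (repeat apply Rmult_integral_contrapositive_currified; lra).
  replace (2 * m * (m + 1) * ((n * (m - 1) + 2) / (2 * m) * ((n' * (m - 1) + m + 1) / (m + 1))))
    with ((m - 1) * (n' * (m - 1) + m + 1) * n + 2 * (n' * (m - 1) + m + 1)) by (field; lra).
  replace ((m - 1) * (n' * (m - 1) + m + 1) * (2 * (m + 1 - n') / (n' * (m - 1) + m + 1)))
    with (2 * m * (m + 1) - 2 * (n' * (m - 1) + m + 1)) by (field; exact HB).
  split; intros; lra.
Qed.

(** In the critical case x = 0 only the branch y = x is left, in agreement with the strict
    inequality required for the second option. *)
Lemma identified_to_ple (m n beta p n' beta' : R) :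
  m <> 1 -> 0 < n -> 1 < p -> p <> 2 -> n' <> -1 -> n' <> -2 ->
  (identified 1 m n beta p n' beta' <->
   p = m + 1 /\
   ((n' = to_ple_dim1 m n /\ beta' = to_ple_beta1 m beta) \/
    (pme_mc n < m /\
     n' = to_ple_dim2 m n /\ beta' = to_ple_beta2 m n beta))) /\
  (identified (-1) m n beta p n' beta' <->
   p = m + 1 /\ m < pme_mc n /\
   n' = to_ple_dim2 m n /\ beta' = to_ple_beta2 m n beta).
Proof.
  intros Hm Hn Hp Hp2 H1 H2.
  destruct (Req_dec p (m + 1)) as [->|Np].
  2:{ assert (K : forall eps, ~ identified eps m n beta p n' beta').
      { intros eps H. apply Np, c1_eq_iff; try assumption. apply H. }
      split; split; intros H; exfalso; try exact (K _ H); apply Np; apply H. }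
  assert (Hm0 : 0 < m) by lra.
  rewrite !identified_iff by (try assumption; try lra; auto).
  assert (B1 : (m + 1) * beta' = 2 * m * beta <-> beta' = to_ple_beta1 m beta).
  { unfold to_ple_beta1. rewrite <- (eq_mul_iff (m + 1) beta') by lra.
    replace ((m + 1) * (2 * m / (m + 1) * beta)) with (2 * m * beta) by (field; lra).
    reflexivity. }
  assert (B2 : (m + 1) * beta' = 2 * m * pme_ratio m n * beta <-> beta' = to_ple_beta2 m n beta).
  { unfold to_ple_beta2, pme_ratio. rewrite <- (eq_mul_iff (m + 1) beta') by lra.
    replace ((m + 1) * ((2 + n * (m - 1)) / (m + 1) * beta))
      with (2 * m * ((n * (m - 1) + 2) / (2 * m)) * beta) by (field; lra).
    reflexivity. }
  assert (Ex : pme_ratio m n = / (2 * m) * (n * (m - 1) + 2)) by (unfold pme_ratio; field; lra).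
  assert (Hi : 0 < / (2 * m)) by (apply Rinv_0_lt_compat; lra).
  assert (S1 : 0 < 1 * pme_ratio m n <-> pme_mc n < m).
  { rewrite pme_mc_lt_iff by exact Hn. rewrite Rmult_1_l, Ex.
    apply scaled_pos_iff. exact Hi. }
  assert (S2 : 0 < -1 * pme_ratio m n <-> m < pme_mc n).
  { rewrite pme_mc_gt_iff by exact Hn. rewrite Ex.
    replace (-1 * (/ (2 * m) * (n * (m - 1) + 2))) with (/ (2 * m) * - (n * (m - 1) + 2)) by ring.
    apply scaled_pos_iff. exact Hi. }
  rewrite same_branch_to_ple, B1, B2, S1, S2 by assumption.
  destruct (Req_dec (n * (m - 1) + 2) 0) as [Z|Z].
  - assert (Z1 : ~ pme_mc n < m) by (rewrite pme_mc_lt_iff by exact Hn; lra).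
    assert (Z2 : ~ m < pme_mc n) by (rewrite pme_mc_gt_iff by exact Hn; lra).
    assert (-1 <> 1) by lra. tauto.
  - rewrite inverse_branch_to_ple by assumption. assert (-1 <> 1) by lra. tauto.
Qed.

(** The sign condition is on [x] in [identified_iff]; on the branch x y = 1 it is the same
    condition on [y], whose sign is that of p - p_c. *)
Lemma identified_to_pme (p n' beta' m n beta : R) :
  1 < p -> p <> 2 -> 0 < n' -> m <> 1 -> n <> 0 -> n <> -2 ->
  (identified 1 m n beta p n' beta' <->
   m = p - 1 /\
   ((n = to_pme_dim1 p n' /\ beta = to_pme_beta1 p beta') \/
    (ple_pc n' < p /\
     n = to_pme_dim2 p n' /\ beta = to_pme_beta2 p n' beta'))) /\
  (identified (-1) m n beta p n' beta' <->
   m = p - 1 /\ p < ple_pc n' /\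
   n = to_pme_dim2 p n' /\ beta = to_pme_beta2 p n' beta').
Proof.
  intros Hp Hp2 Hn' Hm Hn Hn2.
  destruct (Req_dec p (m + 1)) as [->|Np].
  2:{ assert (K : forall eps, ~ identified eps m n beta p n' beta').
      { intros eps H. apply Np, c1_eq_iff; try assumption. apply H. }
      assert (Np' : m <> p - 1) by lra.
      split; split; intros H; exfalso; try exact (K _ H); apply Np'; apply H. }
  assert (Hm0 : 0 < m) by lra.
  rewrite !identified_iff by (try assumption; try lra; auto).
  assert (Ey : ple_ratio m n' = / (m + 1) * (n' * (m + 1 - 2) + (m + 1)))
    by (unfold ple_ratio; field; lra).
  assert (Hi : 0 < / (m + 1)) by (apply Rinv_0_lt_compat; lra).
  assert (B1 : (m + 1) * beta' = 2 * m * beta <-> beta = to_pme_beta1 (m + 1) beta').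
  { unfold to_pme_beta1. rewrite <- (eq_mul_iff (2 * m) beta) by lra.
    replace (2 * m * ((m + 1) / (2 * (m + 1 - 1)) * beta')) with ((m + 1) * beta') by (field; lra).
    split; intros; lra. }
  assert (B2 : pme_ratio m n * ple_ratio m n' = 1 ->
     ((m + 1) * beta' = 2 * m * pme_ratio m n * beta <-> beta = to_pme_beta2 (m + 1) n' beta')).
  { intros Hxy. unfold to_pme_beta2. rewrite <- (eq_mul_iff (2 * m) beta) by lra.
    replace (2 * m * ((m + 1 + n' * (m + 1 - 2)) / (2 * (m + 1 - 1)) * beta'))
      with (ple_ratio m n' * ((m + 1) * beta')) by (rewrite Ey; field; lra).
    split; intros H.
    - rewrite H. transitivity (pme_ratio m n * ple_ratio m n' * (2 * m * beta));
        [rewrite Hxy; ring | ring].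
    - transitivity (pme_ratio m n * ple_ratio m n' * ((m + 1) * beta')); [rewrite Hxy; ring|].
      transitivity (pme_ratio m n * (ple_ratio m n' * ((m + 1) * beta'))); [ring|].
      rewrite <- H. ring. }
  assert (SS : forall eps, pme_ratio m n * ple_ratio m n' = 1 ->
                (0 < eps * pme_ratio m n <-> 0 < eps * ple_ratio m n')).
  { intros eps Hxy. set (x := pme_ratio m n) in *. set (y := ple_ratio m n') in *.
    assert (Hx : x <> 0) by (intros E0; rewrite E0 in Hxy; lra).
    assert (Hy : y <> 0) by (intros E0; rewrite E0 in Hxy; lra).
    split; intros H.
    - replace (eps * y) with (y ^ 2 * (eps * x)).
      + apply Rmult_lt_0_compat; [apply pow2_gt_0; exact Hy | exact H].
      + transitivity (x * y * (eps * y)); [ring | rewrite Hxy; ring].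
    - replace (eps * x) with (x ^ 2 * (eps * y)).
      + apply Rmult_lt_0_compat; [apply pow2_gt_0; exact Hx | exact H].
      + transitivity (x * y * (eps * x)); [ring | rewrite Hxy; ring]. }
  assert (S1 : 0 < 1 * ple_ratio m n' <-> ple_pc n' < m + 1).
  { rewrite ple_pc_lt_iff by exact Hn'. rewrite Rmult_1_l, Ey.
    apply scaled_pos_iff. exact Hi. }
  assert (S2 : 0 < -1 * ple_ratio m n' <-> m + 1 < ple_pc n').
  { rewrite ple_pc_gt_iff by exact Hn'. rewrite Ey.
    replace (-1 * (/ (m + 1) * (n' * (m + 1 - 2) + (m + 1))))
      with (/ (m + 1) * - (n' * (m + 1 - 2) + (m + 1))) by ring.
    apply scaled_pos_iff. exact Hi. }
  rewrite <- S1, <- S2, same_branch_to_pme, B1 by assumption.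
  assert (T1 := SS 1). assert (T2 := SS (-1)).
  assert (N1 : -1 <> 1) by lra.
  assert (Em : m = m + 1 - 1) by ring.
  destruct (Req_dec (n' * (m - 1) + m + 1) 0) as [Z|Z].
  - assert (Zy : ple_ratio m n' = 0) by (unfold ple_ratio; rewrite Z; field; lra).
    assert (Z1 : ~ 0 < 1 * ple_ratio m n') by (rewrite Zy; lra).
    assert (Z2 : ~ 0 < -1 * ple_ratio m n') by (rewrite Zy; lra).
    assert (Z3 : pme_ratio m n * ple_ratio m n' <> 1) by (rewrite Zy; lra).
    tauto.
  - rewrite <- inverse_branch_to_pme by assumption. tauto.
Qed.

(** The second dimension has the sign of (2 - n) B with B = n (m - 1) + 2.  Here
    B = 2 - n + n m exceeds 2 - n, so both factors are positive or both are negative as soon as the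
    first, respectively the second, is.  The two dimensions coincide when x^2 = 1, and x = 1
    means n = 2. *)
Lemma to_ple_dims (m n : R) : m <> 1 -> 0 < n -> 0 < m ->
  (0 < to_ple_dim1 m n <-> 2 < n) /\
  (m <> pme_mc n ->
    (0 < to_ple_dim2 m n <-> n < 2 \/ m < pme_mc n) /\
    (to_ple_dim1 m n = to_ple_dim2 m n <-> n = 2 \/ m = pme_ms n)).
Proof.
  intros Hm Hn Hm0. split.
  - unfold to_ple_dim1.
    replace ((m + 1) * (n - 2) / (2 * m)) with ((m + 1) / (2 * m) * (n - 2)) by (field; lra).
    rewrite scaled_pos_iff by (apply Rdiv_lt_0_compat; lra). split; intros; lra.
  - intros Hc.
    assert (HB : n * (m - 1) + 2 <> 0).
    { rewrite pme_mc_gap by lra. apply Rmult_integral_contrapositive_currified; lra. }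
    rewrite pme_mc_gt_iff, pme_ms_iff by assumption.
    assert (Hnm : 0 < n * m) by (apply Rmult_lt_0_compat; assumption).
    split.
    + unfold to_ple_dim2. set (B := n * (m - 1) + 2) in *.
      assert (EB : B = 2 - n + n * m) by (unfold B; ring).
      replace ((m + 1) * (2 - n) / (2 + n * (m - 1)))
        with ((m + 1) * / B ^ 2 * ((2 - n) * B))
        by (unfold B in *; field; lra).
      rewrite scaled_pos_iff.
      2:{ apply Rmult_lt_0_compat; [lra | apply Rinv_0_lt_compat, pow2_gt_0, HB]. }
      split.
      * intros H. destruct (Rlt_le_dec n 2) as [L|L]; [left; exact L | right].
        destruct (Rlt_le_dec B 0) as [L'|L']; [lra|]. exfalso.
        assert ((2 - n) * B <= 0 * B) by (apply Rmult_le_compat_r; lra). lra.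
      * intros [H|H].
        -- apply Rmult_lt_0_compat; lra.
        -- replace ((2 - n) * B) with ((n - 2) * - B) by ring.
           apply Rmult_lt_0_compat; lra.
    + unfold to_ple_dim1, to_ple_dim2.
      rewrite <- (eq_mul_iff (2 * m * (n * (m - 1) + 2) / (m + 1))).
      2:{ unfold Rdiv. repeat apply Rmult_integral_contrapositive_currified; try lra.
          apply Rinv_neq_0_compat. lra. }
      replace (2 * m * (n * (m - 1) + 2) / (m + 1) * ((m + 1) * (n - 2) / (2 * m)))
        with ((n * (m - 1) + 2) * (n - 2)) by (field; lra).
      replace (2 * m * (n * (m - 1) + 2) / (m + 1) * ((m + 1) * (2 - n) / (2 + n * (m - 1))))
        with (2 * m * (2 - n)) by (field; split; lra).
      split.
      * intros H.
        assert (K : (n - 2) * (n * (m - 1) + 2 + 2 * m) = 0) by lra.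
        apply Rmult_integral in K. lra.
      * intros [->|H]; [ring|].
        transitivity ((n - 2) * (n * (m - 1) + 2 + 2 * m) + 2 * m * (2 - n)); [ring|].
        rewrite H. ring.
Qed.

(** The argument of [to_ple_dims], with B = p - n' + n' (p - 1).  The two dimensions coincide
    when y^2 = 1, and y = 1 is excluded by n' > 0. *)
Lemma to_pme_dims (p n' : R) : 1 < p -> p <> 2 -> 0 < n' ->
  0 < to_pme_dim1 p n' /\
  (p <> ple_pc n' ->
    (0 < to_pme_dim2 p n' <-> n' < p \/ p < ple_pc n') /\
    (to_pme_dim1 p n' = to_pme_dim2 p n' <-> p = ple_ps n')).
Proof.
  intros Hp Hp2 Hn.
  assert (Hnp : 0 < n' * (p - 1)) by (apply Rmult_lt_0_compat; lra).
  split.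
  - unfold to_pme_dim1.
    assert (0 < 2 * (p - 1) * n' / p).
    { apply Rdiv_lt_0_compat; [|lra]. lra. }
    lra.
  - intros Hc.
    assert (HB : n' * (p - 2) + p <> 0).
    { rewrite ple_pc_gap by lra. apply Rmult_integral_contrapositive_currified; lra. }
    rewrite ple_pc_gt_iff, ple_ps_iff by assumption.
    split.
    + unfold to_pme_dim2. set (B := n' * (p - 2) + p) in *.
      assert (EB : B = p - n' + n' * (p - 1)) by (unfold B; ring).
      replace (2 * (p - n') / (p + n' * (p - 2)))
        with (2 * / B ^ 2 * ((p - n') * B))
        by (unfold B in *; field; lra).
      rewrite scaled_pos_iff.
      2:{ apply Rmult_lt_0_compat; [lra | apply Rinv_0_lt_compat, pow2_gt_0, HB]. }
      split.
      * intros H. destruct (Rlt_le_dec n' p) as [L|L]; [left; exact L | right].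
        destruct (Rlt_le_dec B 0) as [L'|L']; [lra|]. exfalso.
        assert ((p - n') * B <= 0 * B) by (apply Rmult_le_compat_r; lra). lra.
      * intros [H|H].
        -- apply Rmult_lt_0_compat; lra.
        -- replace ((p - n') * B) with ((n' - p) * - B) by ring.
           apply Rmult_lt_0_compat; lra.
    + unfold to_pme_dim1, to_pme_dim2.
      rewrite <- (eq_mul_iff (p * (n' * (p - 2) + p) / 2)).
      2:{ unfold Rdiv. repeat apply Rmult_integral_contrapositive_currified; lra. }
      replace (p * (n' * (p - 2) + p) / 2 * (2 + 2 * (p - 1) * n' / p))
        with ((n' * (p - 2) + p) * (p + (p - 1) * n')) by (field; lra).
      replace (p * (n' * (p - 2) + p) / 2 * (2 * (p - n') / (p + n' * (p - 2))))
        with (p * (p - n')) by (field; lra).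
      assert (F : (n' * (p - 2) + p) * (p + (p - 1) * n') - p * (p - n')
                  = n' * (p - 1) * (n' * (p - 2) + 2 * p)) by ring.
      split.
      * intros H. assert (K : n' * (p - 1) * (n' * (p - 2) + 2 * p) = 0) by lra.
        apply Rmult_integral in K. lra.
      * intros H. rewrite H in F. lra.
Qed.

(** * The reduction and the translation rule *)

Theorem theorem1p1 :
  (* reduction of the PME *)
  (forall (ty : ss_type) (m n alpha beta : R) (a0 b0 : Rbar),
    m <> 1 -> 0 < n -> (m - 1) * alpha + 2 * beta = ss_sgn ty ->
    let s := pme_scale m n in
    let J := Ioo a0 b0 in
    let D := eta_dom s J in
    let system := solves_system ty (pme_c1 m) (pme_c2 m n beta) (pme_c3 m n)
                    (pme_b m n) J in
    (forall (T : R) (f : R -> R),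
       pme_radial_solution m n (ss_dom ty T beta D)
         (selfsimilar ty T alpha beta f)
       <-> pme_profile m n alpha beta D f) /\
    (forall f : R -> R, pme_profile m n alpha beta D f ->
       (forall eta, D eta -> 0 < pme_Psi m n f eta) /\
       system (fun r => pme_Phi m n f (exp (r / s)))
              (fun r => pme_Psi m n f (exp (r / s)))) /\
    (forall Phi Psi : R -> R, system Phi Psi -> (forall r, J r -> 0 < Psi r) ->
       exists f : R -> R, pme_profile m n alpha beta D f /\
         forall eta, D eta -> pme_Phi m n f eta = Phi (s * ln eta) /\
                              pme_Psi m n f eta = Psi (s * ln eta)) /\
    (forall f1 f2 : R -> R,
       pme_profile m n alpha beta D f1 -> pme_profile m n alpha beta D f2 ->
       (forall eta, D eta -> pme_Phi m n f1 eta = pme_Phi m n f2 eta /\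
                             pme_Psi m n f1 eta = pme_Psi m n f2 eta) ->
       forall eta, D eta -> f1 eta = f2 eta))
  /\
  (* reduction of the PLE *)
  (forall (ty : ss_type) (p n alpha beta : R) (a0 b0 : Rbar),
    1 < p -> p <> 2 -> 0 < n -> (p - 2) * alpha + p * beta = ss_sgn ty ->
    let s := ple_scale p n in
    let J := Ioo a0 b0 in
    let D := eta_dom s J in
    let system := solves_system ty (ple_c1 p) (ple_c2 p n beta) (ple_c3 p n)
                    (ple_b p n) J in
    (forall (T : R) (f : R -> R),
       ple_radial_solution p n (ss_dom ty T beta D)
         (selfsimilar ty T alpha beta f)
       <-> ple_profile p n alpha beta D f) /\
    (forall f : R -> R, ple_profile_pos p n alpha beta D f ->
       (forall eta, D eta -> 0 < ple_Psi p n f eta) /\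
       system (fun r => ple_Phi p n alpha beta f (exp (r / s)))
              (fun r => ple_Psi p n f (exp (r / s)))) /\
    (forall Phi Psi : R -> R, system Phi Psi -> (forall r, J r -> 0 < Psi r) ->
       ((exists f : R -> R, ple_profile_pos p n alpha beta D f /\
           forall eta, D eta -> ple_Phi p n alpha beta f eta = Phi (s * ln eta) /\
                                ple_Psi p n f eta = Psi (s * ln eta))
        <->
        (* no restriction unless alpha = 0, in which case Phi is by its
           definition a function of Psi *)
        (alpha <> 0 \/
         forall r, J r ->
           Phi r = - ((p - 2) / ((p - 1) * s))
                   * (ple_gamma p - n - beta * (s ^ 2 * (p - 1) * Psi r))))) /\
    (forall f1 f2 : R -> R,
       ple_profile_pos p n alpha beta D f1 -> ple_profile_pos p n alpha beta D f2 ->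
       (forall eta, D eta ->
          ple_Phi p n alpha beta f1 eta = ple_Phi p n alpha beta f2 eta /\
          ple_Psi p n f1 eta = ple_Psi p n f2 eta) ->
       exists k : R, (alpha <> 0 -> k = 0) /\
         forall eta, D eta -> f1 eta = f2 eta + k))
  /\
  (* translation of solutions *)
  (forall (ty : ss_type) (m n alpha beta p n' alpha' beta' eps : R) (a0 b0 : Rbar),
    m <> 1 -> 0 < n -> (m - 1) * alpha + 2 * beta = ss_sgn ty ->
    1 < p -> p <> 2 -> 0 < n' -> (p - 2) * alpha' + p * beta' = ss_sgn ty ->
    eps = 1 \/ eps = -1 ->
    identified eps m n beta p n' beta' ->
    let J := Ioo a0 b0 in
    let D := eta_dom (pme_scale m n) J in
    let D' := eta_dom (eps * ple_scale p n') J in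
    (alpha' <> 0 ->
     forall f : R -> R, pme_profile m n alpha beta D f ->
       exists g : R -> R, ple_profile_pos p n' alpha' beta' D' g /\
         corresponding eps m n p n' alpha' beta' J f g) /\
    (forall g : R -> R, ple_profile_pos p n' alpha' beta' D' g ->
       exists f : R -> R, pme_profile m n alpha beta D f /\
         corresponding eps m n p n' alpha' beta' J f g) /\
    (* the dimension changes, apart from exceptional values *)
    (n' = n -> n = 1 \/ m = pme_ms n))
  /\
  (* the options from PME to PLE; n' <> -1, -2 makes p_c and p_s meaningful *)
  (forall m n beta : R, m <> 1 -> 0 < n ->
    (forall p n' beta' : R, 1 < p -> p <> 2 -> n' <> -1 -> n' <> -2 ->
      (identified 1 m n beta p n' beta' <->
       p = m + 1 /\
       ((n' = to_ple_dim1 m n /\ beta' = to_ple_beta1 m beta) \/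
        (pme_mc n < m /\
         n' = to_ple_dim2 m n /\ beta' = to_ple_beta2 m n beta))) /\
      (identified (-1) m n beta p n' beta' <->
       p = m + 1 /\ m < pme_mc n /\
       n' = to_ple_dim2 m n /\ beta' = to_ple_beta2 m n beta)) /\
    (0 < m ->
      (0 < to_ple_dim1 m n <-> 2 < n) /\
      (m <> pme_mc n ->
        (0 < to_ple_dim2 m n <-> n < 2 \/ m < pme_mc n) /\
        (to_ple_dim1 m n = to_ple_dim2 m n <-> n = 2 \/ m = pme_ms n))))
  /\
  (* the options from PLE to PME; n <> 0, -2 makes m_c and m_s meaningful *)
  (forall p n' beta' : R, 1 < p -> p <> 2 -> 0 < n' ->
    (forall m n beta : R, m <> 1 -> n <> 0 -> n <> -2 ->
      (identified 1 m n beta p n' beta' <->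
       m = p - 1 /\
       ((n = to_pme_dim1 p n' /\ beta = to_pme_beta1 p beta') \/
        (ple_pc n' < p /\
         n = to_pme_dim2 p n' /\ beta = to_pme_beta2 p n' beta'))) /\
      (identified (-1) m n beta p n' beta' <->
       m = p - 1 /\ p < ple_pc n' /\
       n = to_pme_dim2 p n' /\ beta = to_pme_beta2 p n' beta')) /\
    0 < to_pme_dim1 p n' /\
    (p <> ple_pc n' ->
      (0 < to_pme_dim2 p n' <-> n' < p \/ p < ple_pc n') /\
      (to_pme_dim1 p n' = to_pme_dim2 p n' <-> p = ple_ps n'))).
Proof.
  split; [|split; [|split; [|split]]].
  - intros ty m n alpha beta a0 b0 Hm Hn Hexp s J D system.
    split; [|split; [|split]].
    + intros T f. apply pme_selfsimilar_iff; [apply eta_dom_open_positive | exact Hexp].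
    + intros f Hf. exact (pme_to_system ty m n alpha beta a0 b0 f Hm Hn Hexp Hf).
    + intros Phi Psi Hsys HPsi.
      exact (pme_of_system ty m n alpha beta a0 b0 Phi Psi Hm Hn Hexp Hsys HPsi).
    + intros f1 f2 H1 H2 HE eta He.
      apply (pme_Psi_inj m n f1 f2 eta Hm); [apply He | apply H1 | apply H2 | apply HE];
        exact He.
  - intros ty p n alpha beta a0 b0 Hp Hp2 Hn Hexp s J D system.
    split; [|split; [|split]].
    + intros T f. apply ple_selfsimilar_iff; [apply eta_dom_open_positive | exact Hexp].
    + intros f Hf. exact (ple_to_system ty p n alpha beta a0 b0 f Hp Hp2 Hn Hexp Hf).
    + intros Phi Psi Hsys HPsi.
      exact (ple_of_system ty p n alpha beta a0 b0 Phi Psi Hp Hp2 Hn Hexp Hsys HPsi).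
    + intros f1 f2. exact (ple_unique p n alpha beta a0 b0 f1 f2 Hp Hp2 Hn).
  - intros ty m n alpha beta p n' alpha' beta' eps a0 b0 Hm Hn Hexp Hp Hp2 Hn' Hexp'
      Heps Hid J D D'.
    destruct (translation ty m n alpha beta p n' alpha' beta' eps a0 b0
                Hm Hn Hexp Hp Hp2 Hn' Hexp' Heps Hid) as [T1 T2].
    split; [exact T1 | split; [exact T2|]].
    intros ->. exact (dimension_changes m n beta p beta' eps Hm Hn Hp Hp2 Heps Hid).
  - intros m n beta Hm Hn. split.
    + intros p n' beta' Hp Hp2 H1 H2.
      exact (identified_to_ple m n beta p n' beta' Hm Hn Hp Hp2 H1 H2).
    + intros Hm0. exact (to_ple_dims m n Hm Hn Hm0).
  - intros p n' beta' Hp Hp2 Hn'. split.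
    + intros m n beta Hm Hn Hn2.
      exact (identified_to_pme p n' beta' m n beta Hp Hp2 Hn' Hm Hn Hn2).
    + exact (to_pme_dims p n' Hp Hp2 Hn').
Qed.
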